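(* Let $\alpha\in(0,1]$ and let $c>1$. For any unitary, Virasoro invariant, modular invariant 2D CFT with central charge $c$ (in the sense of the context), define $$\mathcal{E}^{\rm Vir}(\beta_L,\beta_R)=\log Z^{\rm Vir}(\beta_L,\beta_R)-\frac{c-1}{24}(\beta_L+\beta_R).$$ Then for every $(\beta_L,\beta_R)\in\mathcal{D}_\alpha$, the algorithm $\mathsf{A}_\alpha$ started at $(\beta_L,\beta_R)$ stops after finitely many points $(\beta_L^{(1)},\beta_R^{(1)}),\dots,(\beta_L^{(N)},\beta_R^{(N)})$, and $$\mathcal{E}^{\rm Vir}(\beta_L,\beta_R)\leqslant\log\Bigg[\sum_{i=1}^N\Big(\prod_{j=2}^{i}\sqrt{\tfrac{\beta_L^{(j)}\beta_R^{(j)}}{4\pi^2}}\Big)\tilde Z_L^{\rm Vir}\big(\alpha;\beta_L^{(i)},\beta_R^{(i)}\big)+\Big(\prod_{j=2}^{N}\sqrt{\tfrac{\beta_L^{(j)}\beta_R^{(j)}}{4\pi^2}}\Big)\tilde Z_H^{\rm Vir}\big(\alpha;\beta_L^{(N)},\beta_R^{(N)}\big)\Bigg],$$ where empty products equal $1$.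
   Context: Let $\eta(\beta)=e^{-\beta/24}\prod_{n\geqslant1}(1-e^{-n\beta})$. A unitary, Virasoro invariant, modular invariant 2D CFT with central charge $c>1$ is given by a countable set of Virasoro primary weights $(h,\bar h)$, $h,\bar h\geqslant0$, with multiplicities $n_{h,\bar h}\in\mathbb{N}$, where the vacuum $(0,0)$ has multiplicity $1$ and primaries with $h=0$ or $\bar h=0$ other than the vacuum have the form $(J,0)$ or $(0,J)$ with $J$ a positive integer; the partition function is $Z(\beta_L,\beta_R)=\sum n_{h,\bar h}\chi_h(\beta_L)\chi_{\bar h}(\beta_R)$ with $\chi_0(\beta)=\frac{e^{\frac{c-1}{24}\beta}}{\eta(\beta)}(1-e^{-\beta})$ and $\chi_h(\beta)=\frac{e^{\frac{c-1}{24}\beta}}{\eta(\beta)}e^{-h\beta}$ for $h>0$; $Z$ is finite for all $\beta_L,\beta_R>0$ and $Z(\beta_L,\beta_R)=Z(4\pi^2/\beta_L,4\pi^2/\beta_R)$. Set $Z^{\rm Vir}(\beta_L,\beta_R)=Z(\beta_L,\beta_R)\eta(\beta_L)\eta(\beta_R)$. Define $$\tilde Z_L^{\rm Vir}(\alpha;\beta_L,\beta_R)=(1-e^{-\beta_L})(1-e^{-\beta_R})+\sum_{0<\min(h,\bar h)<\frac{\alpha(c-1)}{24}}n_{h,\bar h}e^{-h\beta_L-\bar h\beta_R}+\sum_{J\geqslant1}n_{J,0}e^{-J\beta_L}(1-e^{-\beta_R})+\sum_{J\geqslant1}n_{0,J}(1-e^{-\beta_L})e^{-J\beta_R},$$ $$\tilde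 Z_H^{\rm Vir}(\alpha;\beta_L,\beta_R)=\sum_{h,\bar h\geqslant\frac{\alpha(c-1)}{24}}n_{h,\bar h}e^{-h\beta_L-\bar h\beta_R}.$$ Let $\phi_\alpha(\beta)=\max\left\{\frac{4\pi^2}{\beta},\ \frac12\left(\alpha(4\pi-\beta)+\sqrt{\alpha^2(4\pi-\beta)^2+16\pi^2(1-\alpha)}\right)\right\}$ and $\mathcal{D}_\alpha=\{\beta_R>2\pi,\ \beta_L>\phi_\alpha(\beta_R)\}\cup\{\beta_L>2\pi,\ \beta_R>\phi_\alpha(\beta_L)\}$. Algorithm $\mathsf{A}_\alpha$: set $(\beta_L^{(1)},\beta_R^{(1)})=(\beta_L,\beta_R)$. Given $(b_L,b_R)=(\beta_L^{(i)},\beta_R^{(i)})$: (1) if $b_L>2\pi$ and $b_R>2\pi$, stop, $N=i$. (2) If $b_L\leqslant2\pi$: put $\tilde b_L=b_L$ if $b_L<2\pi$, $\tilde b_L=\frac{8\pi^2}{\alpha(b_R-2\pi)+4\pi}$ if $b_L=2\pi$; let $t>0$ be the unique positive solution of $\alpha b_R+\tilde b_L-\frac{4\pi^2}{\tilde b_L}+(1-\alpha)\frac{4\pi^2}{t}-t=0$; set $(\beta_L^{(i+1)},\beta_R^{(i+1)})=(4\pi^2/\tilde b_L,\ t)$. (3) Otherwise ($b_L>2\pi$, $b_R\leqslant2\pi$): the same with $L$ and $R$ exchanged, giving $(\beta_L^{(i+1)},\beta_R^{(i+1)})=(t,\ 4\pi^2/\tilde b_R)$ with $\tilde b_R=b_R$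 if $b_R<2\pi$, $\tilde b_R=\frac{8\pi^2}{\alpha(b_L-2\pi)+4\pi}$ if $b_R=2\pi$, and $t>0$ solving $\alpha b_L+\tilde b_R-\frac{4\pi^2}{\tilde b_R}+(1-\alpha)\frac{4\pi^2}{t}-t=0$. *)

(* Defs.v *)
From Stdlib Require Import Reals List.
From Coquelicot Require Import Coquelicot.
Import ListNotations.
Open Scope R_scope.

Fixpoint eta_pprod (b : R) (N : nat) : R :=
  match N with
  | O => 1
  | S n => eta_pprod b n * (1 - exp (- (INR (S n)) * b))
  end.

Definition eta (b : R) : R :=
  exp (- b / 24) * real (Lim_seq (eta_pprod b)).

Definition chi (c h b : R) : R :=
  exp ((c - 1) / 24 * b) / eta b *
  (if Req_EM_T h 0 then 1 - exp (- b) else exp (- h * b)).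

(** A spectrum is an enumeration of the Virasoro primaries (with
    repetition according to multiplicity): [spec k = Some (h, hb)] means
    the k-th primary has weights (h, hb); [None] entries are unused slots
    (allowing finite as well as countably infinite spectra).
    The multiplicity n_{h,hb} is the number of k with spec k = Some (h,hb). *)
Definition spectrum := nat -> option (R * R).

Definition Z_term (c : R) (spec : spectrum) (bL bR : R) (k : nat) : R :=
  match spec k with
  | None => 0
  | Some (h, hb) => chi c h bL * chi c hb bR
  end.

Definition Zpart (c : R) (spec : spectrum) (bL bR : R) : R :=
  Series (Z_term c spec bL bR).

Definition ZVir (c : R) (spec : spectrum) (bL bR : R) : R :=
  Zpart c spec bL bR * eta bL * eta bR.

Definition EVir (c : R) (spec : spectrum) (bL bR : R) : R :=
  ln (ZVir c spec bL bR) - (c - 1) / 24 * (bL + bR).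

Definition is_CFT (c : R) (spec : spectrum) : Prop :=
  (forall k h hb, spec k = Some (h, hb) -> 0 <= h /\ 0 <= hb) /\
  (forall p : R * R, exists M : nat, forall k, (M <= k)%nat -> spec k <> Some p) /\
  (exists k0, spec k0 = Some (0, 0) /\ forall k, spec k = Some (0, 0) -> k = k0) /\
  (forall k h hb, spec k = Some (h, hb) -> (h = 0 \/ hb = 0) -> (h, hb) <> (0, 0) ->
     exists J : nat, (1 <= J)%nat /\ ((h, hb) = (INR J, 0) \/ (h, hb) = (0, INR J))) /\
  (forall bL bR, 0 < bL -> 0 < bR -> ex_series (Z_term c spec bL bR)) /\
  (forall bL bR, 0 < bL -> 0 < bR ->
     Zpart c spec bL bR = Zpart c spec (4 * PI ^ 2 / bL) (4 * PI ^ 2 / bR)).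

(** Light part tilde Z_L^Vir (the vacuum contribution is the first summand;
    the series collects the light non-vacuum primaries and the currents). *)
Definition ZL_term (alpha c : R) (spec : spectrum) (bL bR : R) (k : nat) : R :=
  match spec k with
  | None => 0
  | Some (h, hb) =>
      if Rlt_dec 0 (Rmin h hb) then
        (if Rlt_dec (Rmin h hb) (alpha * (c - 1) / 24)
         then exp (- h * bL - hb * bR) else 0)
      else if Rlt_dec 0 h then exp (- h * bL) * (1 - exp (- bR))   (* (J,0) *)
      else if Rlt_dec 0 hb then (1 - exp (- bL)) * exp (- hb * bR) (* (0,J) *)
      else 0 (* vacuum, counted separately *)
  end.

Definition ZL_tilde (alpha c : R) (spec : spectrum) (bL bR : R) : R :=
  (1 - exp (- bL)) * (1 - exp (- bR)) + Series (ZL_term alpha c spec bL bR).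

Definition ZH_term (alpha c : R) (spec : spectrum) (bL bR : R) (k : nat) : R :=
  match spec k with
  | None => 0
  | Some (h, hb) =>
      if Rle_dec (alpha * (c - 1) / 24) h then
        (if Rle_dec (alpha * (c - 1) / 24) hb
         then exp (- h * bL - hb * bR) else 0)
      else 0
  end.

Definition ZH_tilde (alpha c : R) (spec : spectrum) (bL bR : R) : R :=
  Series (ZH_term alpha c spec bL bR).

Definition phi (alpha b : R) : R :=
  Rmax (4 * PI ^ 2 / b)
       ((alpha * (4 * PI - b) +
         sqrt (alpha ^ 2 * (4 * PI - b) ^ 2 + 16 * PI ^ 2 * (1 - alpha))) / 2).

Definition in_D (alpha bL bR : R) : Prop :=
  (2 * PI < bR /\ phi alpha bR < bL) \/ (2 * PI < bL /\ phi alpha bL < bR).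

Definition A_stop (p : R * R) : Prop := 2 * PI < fst p /\ 2 * PI < snd p.

Definition A_step (alpha : R) (p q : R * R) : Prop :=
  let (bL, bR) := p in
  if Rle_dec bL (2 * PI) then
    let tb := if Rlt_dec bL (2 * PI) then bL
              else 8 * PI ^ 2 / (alpha * (bR - 2 * PI) + 4 * PI) in
    exists t, 0 < t /\
      alpha * bR + tb - 4 * PI ^ 2 / tb + (1 - alpha) * (4 * PI ^ 2 / t) - t = 0 /\
      q = (4 * PI ^ 2 / tb, t)
  else
    (* here bL > 2 pi, and (as the algorithm has not stopped) bR <= 2 pi *)
    let tb := if Rlt_dec bR (2 * PI) then bR
              else 8 * PI ^ 2 / (alpha * (bL - 2 * PI) + 4 * PI) in
    exists t, 0 < t /\
      alpha * bL + tb - 4 * PI ^ 2 / tb + (1 - alpha) * (4 * PI ^ 2 / t) - t = 0 /\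
      q = (t, 4 * PI ^ 2 / tb).

Definition A_run (alpha bL bR : R) (N : nat) (pts : nat -> R * R) : Prop :=
  (1 <= N)%nat /\
  pts 1%nat = (bL, bR) /\
  (forall i, (1 <= i)%nat -> (i < N)%nat ->
     ~ A_stop (pts i) /\ A_step alpha (pts i) (pts (S i))) /\
  A_stop (pts N).

Definition wgt (p : R * R) : R := sqrt (fst p * snd p / (4 * PI ^ 2)).

Definition prod_w (pts : nat -> R * R) (i : nat) : R :=
  fold_right Rmult 1 (map (fun j => wgt (pts j)) (seq 2 (i - 1))).

Definition bound_rhs (alpha c : R) (spec : spectrum) (N : nat) (pts : nat -> R * R) : R :=
  fold_right Rplus 0
    (map (fun i => prod_w pts i * ZL_tilde alpha c spec (fst (pts i)) (snd (pts i)))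
         (seq 1 N))
  + prod_w pts N * ZH_tilde alpha c spec (fst (pts N)) (snd (pts N)).

(* Main.v *)
Require Import Defs.
From Stdlib Require Import Reals List Lra Lia.
From Coquelicot Require Import Coquelicot.
Open Scope R_scope.

(** Write [Z_red = Z^Vir exp (- (c-1)/24 (bL + bR))], the sum of the light and heavy parts.
    Heavy weights are at least [alpha (c-1)/24], so the heavy part at [b] is at most an
    explicit exponential times [Z_red] at a hotter point [u <= b]; modular
    invariance moves [u] to the next point [q] of the algorithm, and the equation for [t] makes
    the exponential at most 1, leaving the factor [sqrt (qL qR / 4 pi^2)].  Iterating gives the bound.

    With [x] the smaller and [y] the larger inverse temperature, the domain is described by
    [x y > 4 pi^2] and [C > 4 pi alpha] for [C = x - (1 - alpha) 4 pi^2 / x + alpha y].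
    [C] is invariant under the steps, while [x - (1 - alpha) 4 pi^2 / x], which increases with [x],
    grows by a uniform amount at each of them, so [x] exceeds [2 pi] after finitely many steps.

    The modular law [eta (4 pi^2 / b) = sqrt (b / 2 pi) eta b] is obtained by evaluating
    [sum_(0 < j < N) ln (4 sinh^2 (N a_j))], [sinh a_j = s sin (pi j / N)], [N = 2^n]: it is a double
    sum of [ln (4 s^2 sin^2 (pi j / N) + 4 sin^2 (pi k / N))], symmetric under [s -> 1/s] up to
    elementary terms, while the combination of the sums for [2 N] and [N] that cancels the leading
    growth tends to [- 12 ln eta (2 pi s)]. *)

(** * Finite sums *)

Fixpoint rsum (f : nat -> R) (n : nat) : R :=
  match n with
  | O => 0
  | S m => rsum f m + f m
  end.

Lemma rsum_ext (f g : nat -> R) (n : nat) :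
  (forall k, (k < n)%nat -> f k = g k) -> rsum f n = rsum g n.
Proof.
  induction n as [|n IH]; intros H; [reflexivity|]; simpl.
  rewrite IH, H; [reflexivity|lia|intros; apply H; lia].
Qed.

Lemma rsum_plus (f g : nat -> R) (n : nat) :
  rsum (fun k => f k + g k) n = rsum f n + rsum g n.
Proof. induction n as [|n IH]; simpl; [ring|rewrite IH; ring]. Qed.

Lemma rsum_scal (a : R) (f : nat -> R) (n : nat) :
  rsum (fun k => a * f k) n = a * rsum f n.
Proof. induction n as [|n IH]; simpl; [ring|rewrite IH; ring]. Qed.

Lemma rsum_const (a : R) (n : nat) : rsum (fun _ => a) n = INR n * a.
Proof. induction n as [|n IH]; [simpl; ring|rewrite S_INR; simpl; rewrite IH; ring]. Qed.

Lemma rsum_swap (f : nat -> nat -> R) (m n : nat) :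
  rsum (fun j => rsum (f j) n) m = rsum (fun k => rsum (fun j => f j k) m) n.
Proof.
  induction m as [|m IH]; simpl.
  - rewrite rsum_const; ring.
  - rewrite IH, rsum_plus; reflexivity.
Qed.

Lemma rsum_S_left (f : nat -> R) (n : nat) :
  rsum f (S n) = f O + rsum (fun k => f (S k)) n.
Proof. induction n as [|n IH]; [simpl; ring|]. simpl in *. rewrite IH; ring. Qed.

Lemma rsum_add (f : nat -> R) (m n : nat) :
  rsum f (m + n) = rsum f m + rsum (fun k => f (m + k)%nat) n.
Proof.
  induction n as [|n IH]; [rewrite Nat.add_0_r; simpl; ring|].
  rewrite Nat.add_succ_r; simpl; rewrite IH; ring.
Qed.

(** Used to fold the upper half of a sum over [0 < j < 2^n] onto the lower half. *)
Lemma rsum_rev (f : nat -> R) (n : nat) :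
  rsum f n = rsum (fun k => f (n - S k)%nat) n.
Proof.
  revert f; induction n as [|n IH]; intros f; [reflexivity|].
  rewrite rsum_S_left; simpl. rewrite Nat.sub_diag, IH.
  rewrite (rsum_ext (fun k => f (S (n - S k))) (fun k => f (n - k)%nat)).
  - ring.
  - intros k Hk; f_equal; lia.
Qed.

Lemma rsum_even_odd (f : nat -> R) (n : nat) :
  rsum f (2 * n) = rsum (fun k => f (2 * k)%nat) n + rsum (fun k => f (2 * k + 1)%nat) n.
Proof.
  induction n as [|n IH]; [simpl; ring|].
  replace (2 * S n)%nat with (S (S (2 * n))) by lia.
  change (rsum f (S (S (2 * n)))) with (rsum f (2 * n) + f (2 * n)%nat + f (S (2 * n))).
  rewrite IH; simpl rsum. replace (S (2 * n)) with (2 * n + 1)%nat by lia. simpl; ring.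
Qed.

Lemma rsum_abs_le (f : nat -> R) (a : R) (n : nat) :
  (forall k, (k < n)%nat -> Rabs (f k) <= a) -> Rabs (rsum f n) <= INR n * a.
Proof.
  induction n as [|n IH]; intros H; [simpl; rewrite Rabs_R0; lra|].
  rewrite S_INR; simpl. eapply Rle_trans; [apply Rabs_triang|].
  specialize (IH (fun k Hk => H k ltac:(lia))). specialize (H n ltac:(lia)). lra.
Qed.

Lemma rsum_telescope (f : nat -> R) (n : nat) :
  rsum (fun k => f (S k) - f k) n = f n - f O.
Proof. induction n as [|n IH]; simpl; [ring|rewrite IH; ring]. Qed.

Lemma rsum_sum_n (f : nat -> R) (n : nat) : rsum f (S n) = sum_n f n.
Proof.
  induction n as [|n IH]; [simpl; rewrite sum_O; ring|].
  rewrite sum_Sn, <- IH; reflexivity.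
Qed.

Lemma INR_two_pow_pos (n : nat) : 0 < INR (2 ^ n).
Proof. apply lt_0_INR. pose proof (Nat.pow_nonzero 2 n). lia. Qed.

(** * The product of [2 cosh t - 2 cos (p + 2 pi k / 2^n)] over [k] *)

Lemma cosh_gt_1 (t : R) : 0 < t -> 1 < cosh t.
Proof.
  intros Ht; unfold cosh. pose proof (exp_ineq1 t ltac:(lra)).
  rewrite exp_Ropp. pose proof (exp_pos t).
  apply Rmult_lt_reg_r with (2 * exp t); [lra|].
  replace ((exp t + / exp t) / 2 * (2 * exp t)) with (exp t * exp t + 1) by (field; lra).
  nra.
Qed.

Lemma cosh_double (t : R) : cosh (2 * t) = 2 * cosh t ^ 2 - 1.
Proof.
  unfold cosh. replace (2 * t) with (t + t) by ring.
  replace (- (t + t)) with (- t + - t) by ring. rewrite !exp_plus.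
  assert (exp t * exp (- t) = 1) by (rewrite <- exp_plus, Rplus_opp_r; apply exp_0).
  nra.
Qed.

Lemma cosh_double_sinh (t : R) : cosh (2 * t) = 2 * sinh t ^ 2 + 1.
Proof.
  unfold cosh, sinh. replace (2 * t) with (t + t) by ring.
  replace (- (t + t)) with (- t + - t) by ring. rewrite !exp_plus.
  assert (exp t * exp (- t) = 1) by (rewrite <- exp_plus, Rplus_opp_r; apply exp_0).
  nra.
Qed.

Lemma cosh_sub_cos_pos (t p : R) : 0 < t -> 0 < 2 * cosh t - 2 * cos p.
Proof. intros Ht. pose proof (cosh_gt_1 t Ht). pose proof (COS_bound p). lra. Qed.

(* The induction doubles both arguments:
   [2 cosh 2t - 2 cos 2p = (2 cosh t - 2 cos p) (2 cosh t - 2 cos (p + PI))]. *)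
Lemma log_cosh_sub_cos (n : nat) (t p : R) : 0 < t ->
  rsum (fun k => ln (2 * cosh t - 2 * cos (p + 2 * PI * INR k / INR (2 ^ n)))) (2 ^ n)
  = ln (2 * cosh (INR (2 ^ n) * t) - 2 * cos (INR (2 ^ n) * p)).
Proof.
  intros Ht. revert p; induction n as [|n IH]; intros p.
  - simpl. rewrite Rplus_0_l, !Rmult_1_l. do 4 f_equal. field.
  - pose proof (INR_two_pow_pos n) as Hp.
    replace (2 ^ S n)%nat with (2 * 2 ^ n)%nat by (simpl; lia).
    rewrite rsum_even_odd.
    rewrite (rsum_ext _ (fun k => ln (2 * cosh t - 2 * cos (p + 2 * PI * INR k / INR (2 ^ n))))).
    2:{ intros k _. do 4 f_equal. rewrite !mult_INR; simpl INR. field. lra. }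
    rewrite IH.
    rewrite (rsum_ext _ (fun k => ln (2 * cosh t - 2 *
         cos ((p + PI / INR (2 ^ n)) + 2 * PI * INR k / INR (2 ^ n))))).
    2:{ intros k _. do 4 f_equal. rewrite plus_INR, !mult_INR; simpl INR. field. lra. }
    rewrite IH.
    assert (Hn : 0 < INR (2 ^ n) * t) by nra.
    rewrite <- ln_mult by (apply cosh_sub_cos_pos; exact Hn).
    f_equal.
    replace (INR (2 ^ n) * (p + PI / INR (2 ^ n))) with (INR (2 ^ n) * p + PI) by (field; lra).
    rewrite neg_cos, mult_INR; simpl (INR 2).
    replace ((1 + 1) * INR (2 ^ n) * t) with (2 * (INR (2 ^ n) * t)) by ring.
    replace ((1 + 1) * INR (2 ^ n) * p) with (2 * (INR (2 ^ n) * p)) by ring.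
    rewrite cosh_double, cos_2a_cos. ring.
Qed.

(** * The double sum and its symmetry under inversion of [s] *)

Definition sinfrac (n k : nat) : R := sin (PI * INR k / INR (2 ^ n)).

Definition asfrac (s : R) (n k : nat) : R := arcsinh (s * sinfrac n k).

Lemma sinfrac_pos (n k : nat) : (0 < k < 2 ^ n)%nat -> 0 < sinfrac n k.
Proof.
  intros [H1 H2]. unfold sinfrac. pose proof (INR_two_pow_pos n) as Hp.
  apply lt_INR in H1; apply lt_INR in H2; simpl in H1. pose proof PI_RGT_0.
  apply sin_gt_0.
  - apply Rdiv_lt_0_compat; nra.
  - apply Rmult_lt_reg_r with (INR (2 ^ n)); [lra|].
    unfold Rdiv; rewrite Rmult_assoc, Rinv_l by lra. nra.
Qed.

Lemma arcsinh_pos (x : R) : 0 < x -> 0 < arcsinh x.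
Proof. intros H. rewrite <- arcsinh_0. apply arcsinh_lt; exact H. Qed.

Lemma asfrac_pos (s : R) (n k : nat) : 0 < s -> (0 < k < 2 ^ n)%nat -> 0 < asfrac s n k.
Proof. intros Hs Hk. apply arcsinh_pos. pose proof (sinfrac_pos n k Hk). nra. Qed.

Lemma ln_four_sinh_sq (u : R) : 0 < u -> ln (4 * sinh u ^ 2) = 2 * u + 2 * ln (1 - exp (- (2 * u))).
Proof.
  intros Hu.
  assert (Hlt : exp (- (2 * u)) < 1) by (rewrite <- exp_0; apply exp_increasing; lra).
  assert (H1 : 0 < exp u * (1 - exp (- (2 * u)))) by (pose proof (exp_pos u); nra).
  replace (4 * sinh u ^ 2)
    (* The square is kept as a product so that [ln_mult] applies to positive factors. *)
    with ((exp u * (1 - exp (- (2 * u)))) * (exp u * (1 - exp (- (2 * u))))).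
  - rewrite !ln_mult, ln_exp by (try exact H1; try apply exp_pos; lra). ring.
  - replace (exp u * (1 - exp (- (2 * u)))) with (2 * sinh u); [ring|].
    unfold sinh. replace (- (2 * u)) with (- u + - u) by ring.
    rewrite exp_plus.
    assert (exp u * exp (- u) = 1) as H by (rewrite <- exp_plus, Rplus_opp_r; apply exp_0).
    transitivity (exp u - (exp u * exp (- u)) * exp (- u)); [rewrite H; field|ring].
Qed.

Definition sinh_log (s : R) (n j : nat) : R :=
  2 * (INR (2 ^ n) * asfrac s n j) + 2 * ln (1 - exp (- (2 * (INR (2 ^ n) * asfrac s n j)))).

(** The product formula at [p = 0], [t = 2 a_j] gives [4 sinh^2 (N a_j)], and in each factor
    [cosh (2 a) = 1 + 2 sinh^2 a] and [cos (2 x) = 1 - 2 sin^2 x] leave a sum of two squares. *)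
Lemma sinh_log_double_sum (s : R) (n j : nat) : 0 < s -> (0 < j < 2 ^ n)%nat ->
  sinh_log s n j = rsum (fun k => ln (4 * s ^ 2 * sinfrac n j ^ 2 + 4 * sinfrac n k ^ 2)) (2 ^ n).
Proof.
  intros Hs Hj. pose proof (asfrac_pos s n j Hs Hj) as Ha. pose proof (INR_two_pow_pos n) as Hp.
  unfold sinh_log. rewrite <- ln_four_sinh_sq by nra.
  replace (4 * sinh (INR (2 ^ n) * asfrac s n j) ^ 2)
    with (2 * cosh (INR (2 ^ n) * (2 * asfrac s n j)) - 2 * cos (INR (2 ^ n) * 0)).
  - rewrite <- log_cosh_sub_cos by lra.
    apply rsum_ext; intros k _. f_equal.
    rewrite cosh_double_sinh. unfold asfrac at 1. rewrite sinh_arcsinh.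
    replace (0 + 2 * PI * INR k / INR (2 ^ n)) with (2 * (PI * INR k / INR (2 ^ n))) by (field; lra).
    rewrite cos_2a_sin. unfold sinfrac. ring.
  - rewrite Rmult_0_r, cos_0.
    replace (INR (2 ^ n) * (2 * asfrac s n j)) with (2 * (INR (2 ^ n) * asfrac s n j)) by ring.
    rewrite cosh_double_sinh. ring.
Qed.

Definition sinh_log_sum (s : R) (n : nat) : R :=
  rsum (fun j => sinh_log s n (S j)) (2 ^ n - 1).

(* The double sum over [0 < j, k < N] is symmetric up to the factor [s^2] in each of its
   [(N-1)^2] logarithms; the row [k = 0] accounts for the remaining [4 (N-1) ln s]. *)
Lemma sinh_log_sum_inv (s : R) (n : nat) : 0 < s ->
  sinh_log_sum s n - sinh_log_sum (/ s) n = 2 * (INR (2 ^ n) ^ 2 - 1) * ln s.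
Proof.
  intros Hs. pose proof (Rinv_0_lt_compat s Hs) as Hs'.
  assert (HN : exists M, (2 ^ n = S M)%nat).
  { exists (2 ^ n - 1)%nat. pose proof (Nat.pow_nonzero 2 n). lia. }
  destruct HN as [M HM].
  assert (Hsp : forall r, 0 < r -> sinh_log_sum r n =
     rsum (fun j => ln (4 * r ^ 2 * sinfrac n (S j) ^ 2)) M +
     rsum (fun j => rsum (fun k => ln (4 * r ^ 2 * sinfrac n (S j) ^ 2 + 4 * sinfrac n (S k) ^ 2)) M) M).
  { intros r Hr. unfold sinh_log_sum. rewrite HM. replace (S M - 1)%nat with M by lia.
    rewrite <- rsum_plus. apply rsum_ext; intros j Hj.
    rewrite sinh_log_double_sum by (try assumption; lia). rewrite HM, rsum_S_left. f_equal.
    f_equal. unfold sinfrac at 2. simpl (INR 0).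
    replace (PI * 0 / INR (2 ^ n)) with 0 by (unfold Rdiv; ring). rewrite sin_0. ring. }
  rewrite !Hsp by assumption.
  rewrite (rsum_swap _ M M) at 1.
  assert (Hln : ln (/ s) = - ln s) by (apply ln_Rinv; exact Hs).
  assert (H4 : forall j, (j < M)%nat -> 0 < 4 * sinfrac n (S j) ^ 2).
  { intros j Hj. pose proof (sinfrac_pos n (S j) ltac:(lia)). nra. }
  rewrite (rsum_ext (fun j => ln (4 * s ^ 2 * sinfrac n (S j) ^ 2))
             (fun j => 4 * ln s + ln (4 * (/ s) ^ 2 * sinfrac n (S j) ^ 2))).
  2:{ intros j Hj. specialize (H4 j Hj).
      replace (4 * s ^ 2 * sinfrac n (S j) ^ 2) with ((s * s) * (4 * sinfrac n (S j) ^ 2)) by ring.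
      replace (4 * (/ s) ^ 2 * sinfrac n (S j) ^ 2)
        with ((/ s * / s) * (4 * sinfrac n (S j) ^ 2)) by ring.
      rewrite !ln_mult, Hln by nra. ring. }
  rewrite rsum_plus, rsum_const.
  rewrite (rsum_ext (fun k => rsum (fun j => ln (4 * s ^ 2 * sinfrac n (S j) ^ 2 + 4 * sinfrac n (S k) ^ 2)) M)
    (fun j => INR M * (2 * ln s) +
      rsum (fun k => ln (4 * (/ s) ^ 2 * sinfrac n (S j) ^ 2 + 4 * sinfrac n (S k) ^ 2)) M)).
  2:{ intros j Hj. rewrite <- rsum_const, <- rsum_plus. apply rsum_ext; intros k Hk.
      pose proof (H4 j Hj); pose proof (H4 k Hk).
      replace (4 * s ^ 2 * sinfrac n (S k) ^ 2 + 4 * sinfrac n (S j) ^ 2)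
        with ((s * s) * (4 * (/ s) ^ 2 * sinfrac n (S j) ^ 2 + 4 * sinfrac n (S k) ^ 2))
        by (field; lra).
      rewrite !ln_mult by nra. ring. }
  rewrite rsum_plus, rsum_const, HM, S_INR. ring.
Qed.

(** * Error of the trapezoidal rule under refinement *)

Lemma deriv_bound_le (f f' : R -> R) (a b B : R) :
  a <= b -> (forall x, a <= x <= b -> is_derive f x (f' x)) ->
  (forall x, a <= x <= b -> Rabs (f' x) <= B) ->
  Rabs (f b - f a) <= B * (b - a).
Proof.
  intros Hab Hd HB.
  destruct (MVT_gen f a b f') as [c [Hc He]].
  - intros x Hx. rewrite Rmin_left, Rmax_right in Hx by lra. apply Hd; lra.
  - intros x Hx. rewrite Rmin_left, Rmax_right in Hx by lra.
    apply continuity_pt_filterlim. apply (ex_derive_continuous f).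
    exists (f' x). apply Hd; lra.
  - rewrite Rmin_left, Rmax_right in Hc by lra.
    rewrite He, Rabs_mult, (Rabs_right (b - a)) by lra.
    apply Rmult_le_compat_r; [lra|]. apply HB; lra.
Qed.

Section Trapezoid.

Variables (f f1 f2 : R -> R) (K : R).
Hypothesis f_deriv : forall x, is_derive f x (f1 x).
Hypothesis f1_deriv : forall x, is_derive f1 x (f2 x).
Hypothesis f2_lip : forall x y, Rabs (f2 x - f2 y) <= K * Rabs (x - y).

(* The error [E h] satisfies [E 0 = 0], and the mean value theorem for [f1] gives
   [|E' h| <= K h^2]. *)
Lemma midpoint_error (m h : R) : 0 <= h ->
  Rabs (f m - (f (m - h) + f (m + h)) / 2 + h / 4 * (f1 (m + h) - f1 (m - h)))
  <= K * h ^ 3.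
Proof.
  intros Hh.
  set (E := fun h => f m - (f (m - h) + f (m + h)) / 2 + h / 4 * (f1 (m + h) - f1 (m - h))).
  assert (HK : 0 <= K).
  { pose proof (f2_lip 1 0) as H. rewrite Rminus_0_r, Rabs_R1 in H.
    pose proof (Rabs_pos (f2 1 - f2 0)). lra. }
  assert (HE0 : E 0 = 0).
  { unfold E. rewrite Rminus_0_r, Rplus_0_r. field. }
  change (Rabs (E h) <= K * h ^ 3).
  replace (E h) with (E h - E 0) by (rewrite HE0; ring).
  replace (K * h ^ 3) with ((K * h ^ 2) * (h - 0)) by ring.
  apply deriv_bound_le with (f' := fun h => - (1 / 4) * (f1 (m + h) - f1 (m - h))
     + h / 4 * (f2 (m + h) + f2 (m - h))); [exact Hh| |].
  - intros x _. unfold E.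
    assert (Hf : forall y, ex_derive f y) by (intros y; exists (f1 y); apply f_deriv).
    assert (Hf1 : forall y, ex_derive f1 y) by (intros y; exists (f2 y); apply f1_deriv).
    auto_derive.
    + repeat split; (exact (Hf _) || exact (Hf1 _)).
    + rewrite !(is_derive_unique _ _ _ (f_deriv _)), !(is_derive_unique _ _ _ (f1_deriv _)).
      unfold Rminus. field.
  - intros x [Hx Hxh].
    destruct (MVT_gen f1 (m - x) (m + x) f2) as [c [Hc He]].
    + intros; apply f1_deriv.
    + intros y _. apply continuity_pt_filterlim. apply (ex_derive_continuous f1).
      exists (f2 y); apply f1_deriv.
    + rewrite Rmin_left, Rmax_right in Hc by lra. rewrite He.
      replace (- (1 / 4) * (f2 c * (m + x - (m - x))) + x / 4 * (f2 (m + x) + f2 (m - x)))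
        with (x / 4 * ((f2 (m + x) - f2 c) + (f2 (m - x) - f2 c))) by field.
      rewrite Rabs_mult, (Rabs_right (x / 4)) by lra.
      pose proof (f2_lip (m + x) c) as H1. pose proof (f2_lip (m - x) c) as H2.
      assert (Rabs (m + x - c) <= 2 * x) by (apply Rabs_le; lra).
      assert (Rabs (m - x - c) <= 2 * x) by (apply Rabs_le; lra).
      pose proof (Rabs_triang (f2 (m + x) - f2 c) (f2 (m - x) - f2 c)).
      assert (Rabs (f2 (m + x) - f2 c + (f2 (m - x) - f2 c)) <= K * (4 * x)) by nra.
      apply Rle_trans with (x / 4 * (K * (4 * x))); [apply Rmult_le_compat_l; lra|].
      replace (x / 4 * (K * (4 * x))) with (K * x ^ 2) by field.
      apply Rmult_le_compat_l; [exact HK|]. apply pow_incr; lra.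
Qed.

(** The nodes of even index on the fine grid form the coarse grid, so the difference is midpoint
    values minus coarse values. Each cell has error [O(h^3)] after its derivative correction; these
    corrections telescope to the boundary term. *)
Lemma trapezoid_refinement (N : nat) : (0 < N)%nat -> f 0 = 0 -> f 1 = 0 ->
  Rabs (4 * INR N * (rsum (fun j => f (INR j / INR (2 * N))) (2 * N)
                     - 2 * rsum (fun j => f (INR j / INR N)) N)
        + (f1 1 - f1 0) / 2) <= K / (2 * INR N).
Proof.
  intros HN H0 H1. apply lt_INR in HN as HN'; simpl in HN'.
  set (h := / (2 * INR N)).
  assert (Hh : 0 < h) by (apply Rinv_0_lt_compat; lra).
  rewrite rsum_even_odd.
  rewrite (rsum_ext _ (fun j => f (INR j / INR N))).
  2:{ intros k _. f_equal. rewrite !mult_INR; simpl INR. field. lra. }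
  (* As [f] vanishes at both ends, the left endpoint sum equals the average of the left and right
     ones. *)
  assert (HT : rsum (fun j => f (INR (S j) / INR N) - f (INR j / INR N)) N = 0).
  { rewrite (rsum_telescope (fun j => f (INR j / INR N)) N). simpl INR.
    replace (INR N / INR N) with 1 by (field; lra).
    replace (0 / INR N) with 0 by (field; lra). rewrite H0, H1; ring. }
  assert (HT1 : rsum (fun j => f1 (INR (S j) / INR N) - f1 (INR j / INR N)) N = f1 1 - f1 0).
  { rewrite (rsum_telescope (fun j => f1 (INR j / INR N)) N). simpl INR.
    replace (INR N / INR N) with 1 by (field; lra).
    replace (0 / INR N) with 0 by (field; lra). reflexivity. }
  set (mid := fun j => INR (2 * j + 1) / INR (2 * N)).
  set (err := fun j => f (mid j) - (f (mid j - h) + f (mid j + h)) / 2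
                       + h / 4 * (f1 (mid j + h) - f1 (mid j - h))).
  assert (Herr : rsum err N = rsum (fun k => f (mid k)) N - rsum (fun j => f (INR j / INR N)) N
     + h / 4 * (f1 1 - f1 0)).
  { assert (Hs : rsum err N + (rsum (fun j => f (INR j / INR N)) N
       + / 2 * rsum (fun j => f (INR (S j) / INR N) - f (INR j / INR N)) N)
       = rsum (fun k => f (mid k)) N
         + h / 4 * rsum (fun j => f1 (INR (S j) / INR N) - f1 (INR j / INR N)) N);
      [|rewrite HT, HT1 in Hs; lra].
    rewrite <- !rsum_scal, <- !rsum_plus. apply rsum_ext; intros j _. unfold err.
    replace (mid j - h) with (INR j / INR N).
    2:{ unfold mid, h. rewrite plus_INR, !mult_INR; simpl INR. field; lra. }
    replace (mid j + h) with (INR (S j) / INR N).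
    2:{ unfold mid, h. rewrite S_INR, plus_INR, !mult_INR; simpl INR. field; lra. }
    field. }
  match goal with |- Rabs ?x <= _ => replace x with (4 * INR N * rsum err N) end.
  2:{ rewrite Herr. change (rsum (fun k => f (INR (2 * k + 1) / INR (2 * N))) N)
        with (rsum (fun k => f (mid k)) N). unfold h. field; lra. }
  rewrite Rabs_mult, (Rabs_right (4 * INR N)) by lra.
  apply Rle_trans with (4 * INR N * (INR N * (K * h ^ 3))).
  - apply Rmult_le_compat_l; [lra|]. apply rsum_abs_le. intros k _. apply midpoint_error; lra.
  - apply Req_le. unfold h. field; lra.
Qed.

End Trapezoid.

(** * The function [arcsinh (s sin (pi x))] and its derivatives *)

Definition asin_sinh (s x : R) : R := arcsinh (s * sin (PI * x)).

Section AsinSinh.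

Variable s : R.
Let w (x : R) : R := 1 + s ^ 2 * sin (PI * x) ^ 2.
Let u (x : R) : R := / sqrt (w x).
Let d1 (x : R) : R := s * PI * cos (PI * x) * u x.
Let d2 (x : R) : R := - s * PI ^ 2 * (1 + s ^ 2) * sin (PI * x) * u x ^ 3.
Let d3 (x : R) : R := - s * PI ^ 3 * (1 + s ^ 2) *
   (cos (PI * x) * u x ^ 3 - 3 * s ^ 2 * sin (PI * x) ^ 2 * cos (PI * x) * u x ^ 5).

Lemma w_ge_1 (x : R) : 1 <= w x.
Proof.
  unfold w. pose proof (pow2_ge_0 s). pose proof (pow2_ge_0 (sin (PI * x))). nra.
Qed.

Lemma u_bound (x : R) : 0 < u x <= 1.
Proof.
  pose proof (w_ge_1 x). unfold u.
  assert (1 <= sqrt (w x)) by (rewrite <- sqrt_1 at 1; apply sqrt_le_1; lra).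
  split; [apply Rinv_0_lt_compat; lra|]. rewrite <- Rinv_1. apply Rinv_le_contravar; lra.
Qed.

Lemma w_u2 (x : R) : w x * u x ^ 2 = 1.
Proof.
  pose proof (w_ge_1 x). unfold u. rewrite pow_inv, pow2_sqrt by lra. field; lra.
Qed.

Lemma u_deriv (x : R) :
  is_derive u x (- PI * s ^ 2 * sin (PI * x) * cos (PI * x) * u x ^ 3).
Proof.
  pose proof (w_ge_1 x) as Hw. pose proof (u_bound x) as Hu.
  unfold u. unfold w in *.
  assert (Hq : sqrt (1 + s ^ 2 * sin (PI * x) ^ 2) <> 0).
  { intros H; apply sqrt_eq_0 in H; lra. }
  auto_derive.
  - repeat split; simpl in *; try lra; exact Hq.
  - simpl in *. field. exact Hq.
Qed.

Lemma asin_sinh_deriv (x : R) : is_derive (asin_sinh s) x (d1 x).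
Proof.
  unfold asin_sinh.
  replace (d1 x) with (scal (s * (PI * cos (PI * x))) (/ sqrt ((s * sin (PI * x)) ^ 2 + 1))).
  - apply (is_derive_comp arcsinh (fun y => s * sin (PI * y))).
    + apply is_derive_Reals. apply derivable_pt_lim_arcsinh.
    + auto_derive; [exact I|ring].
  - unfold scal; simpl; unfold mult; simpl. unfold d1, u, w.
    replace ((s * sin (PI * x)) * ((s * sin (PI * x)) * 1) + 1)
      with (1 + s ^ 2 * sin (PI * x) ^ 2) by ring. simpl. ring.
Qed.

Lemma d1_deriv (x : R) : is_derive d1 x (d2 x).
Proof.
  unfold d1. pose proof (u_deriv x) as Hu. pose proof (w_u2 x) as Hw.
  auto_derive.
  - eexists; exact Hu.
  - match goal with |- context [Derive ?g x] =>
      replace (Derive g x) with (- PI * s ^ 2 * sin (PI * x) * cos (PI * x) * u x ^ 3)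
        by (symmetry; apply is_derive_unique; exact Hu) end. unfold d2.
    assert (Hc : cos (PI * x) ^ 2 = 1 - sin (PI * x) ^ 2).
    { pose proof (sin2_cos2 (PI * x)). unfold Rsqr in *. nra. }
    unfold w in Hw. set (S := sin (PI * x)) in *. set (C := cos (PI * x)) in *.
    (* A factor [w x * u x ^ 2 = 1] is inserted so that every term carries [u x ^ 3]. *)
    transitivity (- s * PI ^ 2 * S * (u x * ((1 + s ^ 2 * S ^ 2) * u x ^ 2) + s ^ 2 * C ^ 2 * u x ^ 3)).
    + rewrite Hw. ring.
    + rewrite Hc. ring.
Qed.

Lemma d2_deriv (x : R) : is_derive d2 x (d3 x).
Proof.
  unfold d2. pose proof (u_deriv x) as Hu.
  auto_derive.
  - eexists; exact Hu.
  - match goal with |- context [Derive ?g x] =>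
      replace (Derive g x) with (- PI * s ^ 2 * sin (PI * x) * cos (PI * x) * u x ^ 3)
        by (symmetry; apply is_derive_unique; exact Hu) end. unfold d3. ring.
Qed.

Lemma d3_bound (x : R) : 0 < s ->
  Rabs (d3 x) <= s * PI ^ 3 * (1 + s ^ 2) * (1 + 3 * s ^ 2).
Proof.
  intros Hs. unfold d3. pose proof PI_RGT_0 as HPI. pose proof (u_bound x) as Hu.
  assert (HP3 : 0 < PI ^ 3) by (apply pow_lt; exact HPI).
  assert (Hs2 : 0 < s ^ 2) by (apply pow_lt; exact Hs).
  assert (HA : 0 <= s * PI ^ 3 * (1 + s ^ 2)).
  { apply Rmult_le_pos; [apply Rmult_le_pos|]; lra. }
  rewrite Rabs_mult. replace (Rabs (- s * PI ^ 3 * (1 + s ^ 2))) with (s * PI ^ 3 * (1 + s ^ 2)).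
  2:{ replace (- s * PI ^ 3 * (1 + s ^ 2)) with (- (s * PI ^ 3 * (1 + s ^ 2))) by ring.
      rewrite Rabs_Ropp, Rabs_right; [reflexivity|]. apply Rle_ge, HA. }
  apply Rmult_le_compat_l; [exact HA|].
  pose proof (COS_bound (PI * x)) as HC. pose proof (SIN_bound (PI * x)) as HS.
  assert (H3 : 0 <= u x ^ 3 <= 1).
  { split; [apply pow_le; lra|]. rewrite <- (pow1 3). apply pow_incr; lra. }
  assert (H5 : 0 <= u x ^ 5 <= 1).
  { split; [apply pow_le; lra|]. rewrite <- (pow1 5). apply pow_incr; lra. }
  eapply Rle_trans; [apply Rabs_triang|]. rewrite Rabs_Ropp, !Rabs_mult.
  rewrite (Rabs_right (u x ^ 3)), (Rabs_right (u x ^ 5)), (Rabs_right 3), (Rabs_right (s ^ 2)) by lra.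
  assert (Hc : 0 <= Rabs (cos (PI * x)) <= 1) by (split; [apply Rabs_pos|apply Rabs_le; lra]).
  assert (Hsn : 0 <= Rabs (sin (PI * x) ^ 2) <= 1).
  { split; [apply Rabs_pos|apply Rabs_le; nra]. }
  set (C := Rabs (cos (PI * x))) in *. set (S := Rabs (sin (PI * x) ^ 2)) in *.
  assert (C * u x ^ 3 <= 1) by nra.
  assert (C * u x ^ 5 <= 1) by nra. assert (0 <= C * u x ^ 5) by nra.
  assert (S * (C * u x ^ 5) <= 1) by nra. nra.
Qed.

Lemma d2_lip (x y : R) : 0 < s ->
  Rabs (d2 x - d2 y) <= (s * PI ^ 3 * (1 + s ^ 2) * (1 + 3 * s ^ 2)) * Rabs (x - y).
Proof.
  intros Hs. destruct (Rle_dec y x) as [H|H].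
  - rewrite (Rabs_right (x - y)) by lra.
    apply deriv_bound_le with d3; [exact H|intros; apply d2_deriv|intros; apply d3_bound; exact Hs].
  - rewrite (Rabs_minus_sym (d2 x)), (Rabs_minus_sym x), (Rabs_right (y - x)) by lra.
    apply deriv_bound_le with d3; [lra|intros; apply d2_deriv|intros; apply d3_bound; exact Hs].
Qed.

(** The boundary term comes from the slopes [pi s] at 0 and [- pi s] at 1. *)
Lemma asin_sinh_refinement : 0 < s -> exists K, forall N : nat, (0 < N)%nat ->
  Rabs (4 * INR N * (rsum (fun j => asin_sinh s (INR j / INR (2 * N))) (2 * N)
                     - 2 * rsum (fun j => asin_sinh s (INR j / INR N)) N) - PI * s) <= K / INR N.
Proof.
  intros Hs. exists ((s * PI ^ 3 * (1 + s ^ 2) * (1 + 3 * s ^ 2)) / 2). intros N HN.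
  assert (H0 : asin_sinh s 0 = 0).
  { unfold asin_sinh. rewrite Rmult_0_r, sin_0, Rmult_0_r. apply arcsinh_0. }
  assert (H1 : asin_sinh s 1 = 0).
  { unfold asin_sinh. rewrite Rmult_1_r, sin_PI, Rmult_0_r. apply arcsinh_0. }
  pose proof (trapezoid_refinement (asin_sinh s) d1 d2 _ asin_sinh_deriv d1_deriv
    (fun x y => d2_lip x y Hs) N HN H0 H1) as H.
  assert (Hu0 : u 0 = 1).
  { unfold u, w. rewrite Rmult_0_r, sin_0. replace (1 + s ^ 2 * 0 ^ 2) with 1 by ring.
    rewrite sqrt_1; field. }
  assert (Hu1 : u 1 = 1).
  { unfold u, w. rewrite Rmult_1_r, sin_PI. replace (1 + s ^ 2 * 0 ^ 2) with 1 by ring.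
    rewrite sqrt_1; field. }
  replace ((d1 1 - d1 0) / 2) with (- (PI * s)) in H.
  - apply lt_INR in HN; simpl in HN.
    replace (s * PI ^ 3 * (1 + s ^ 2) * (1 + 3 * s ^ 2) / 2 / INR N)
      with (s * PI ^ 3 * (1 + s ^ 2) * (1 + 3 * s ^ 2) / (2 * INR N)) by (field; lra).
    exact H.
  - unfold d1. rewrite Hu0, Hu1. replace (PI * 1) with PI by ring. replace (PI * 0) with 0 by ring.
    rewrite cos_0, cos_PI. field.
Qed.

End AsinSinh.

(** * Tails of series and dominated convergence *)

Lemma Series_rsum_tail (a : nat -> R) (J : nat) : ex_series a ->
  Series a = rsum a J + Series (fun k => a (J + k)%nat).
Proof.
  intros Ha. induction J as [|J IH]; [simpl; rewrite Rplus_0_l; reflexivity|].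
  rewrite IH. rewrite (Series_incr_1 (fun k => a (J + k)%nat)).
  - simpl. rewrite Nat.add_0_r.
    rewrite (Series_ext (fun k => a (J + S k)%nat) (fun k => a (S (J + k)))); [ring|].
    intros k; f_equal; lia.
  - apply ex_series_incr_n; exact Ha.
Qed.

Lemma Series_finite (a : nat -> R) (J : nat) :
  (forall k, (J <= k)%nat -> a k = 0) -> Series a = rsum a J.
Proof.
  intros H.
  assert (H0 : is_series (fun k => a (J + k)%nat) 0).
  { apply (is_series_ext (fun _ => 0)).
    - intros k; symmetry; apply H; lia.
    - change (is_lim_seq (sum_n (fun _ => 0)) 0).
      apply (is_lim_seq_ext (fun _ => 0)); [|apply is_lim_seq_const].
      intros k; rewrite <- rsum_sum_n, rsum_const; ring. }
  rewrite (Series_rsum_tail a J).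
  - rewrite (is_series_unique _ _ H0); ring.
  - apply (ex_series_incr_n a J). eexists; exact H0.
Qed.

Lemma is_lim_seq_rsum (F : nat -> nat -> R) (G : nat -> R) (J : nat) :
  (forall j, is_lim_seq (fun n => F n j) (G j)) ->
  is_lim_seq (fun n => rsum (F n) J) (rsum G J).
Proof.
  intros H. induction J as [|J IH]; simpl; [apply is_lim_seq_const|].
  apply is_lim_seq_plus'; [exact IH|apply H].
Qed.

Lemma is_lim_seq_rsum_series (a : nat -> R) :
  ex_series a -> is_lim_seq (rsum a) (Series a).
Proof.
  intros Ha. apply is_lim_seq_incr_1.
  apply (is_lim_seq_ext (sum_n a)); [intros n; symmetry; apply rsum_sum_n|].
  exact (Series_correct a Ha).
Qed.

(** Dominated convergence: the tails beyond [J] are bounded by that of [g], uniformly in [n], and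
    the first [J] terms converge as a finite sum. *)
Lemma tannery (F : nat -> nat -> R) (G g : nat -> R) :
  (forall j, is_lim_seq (fun n => F n j) (G j)) ->
  (forall n j, Rabs (F n j) <= g j) -> ex_series g ->
  is_lim_seq (fun n => Series (F n)) (Series G).
Proof.
  intros HF Hb Hg.
  assert (HG : forall j, Rabs (G j) <= g j).
  { intros j. apply (is_lim_seq_le (fun n => Rabs (F n j)) (fun _ => g j) (Rabs (G j)) (g j)).
    - intros n; apply Hb.
    - apply (is_lim_seq_abs _ (G j)), HF.
    - apply is_lim_seq_const. }
  assert (Htail : forall f J, (forall j, Rabs (f j) <= g j) ->
    Rabs (Series f - rsum f J) <= Series g - rsum g J).
  { intros f J Hf.
    assert (Hgt : ex_series (fun k => g (J + k)%nat)) by (apply (ex_series_incr_n g J), Hg).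
    assert (Hft : ex_series (fun k => Rabs (f (J + k)%nat))).
    { apply (ex_series_le (fun k => Rabs (f (J + k)%nat)) (fun k => g (J + k)%nat)); [|exact Hgt].
      intros k. unfold norm; simpl. unfold abs; simpl. rewrite Rabs_Rabsolu. apply Hf. }
    rewrite (Series_rsum_tail f J), (Series_rsum_tail g J) by
      first [exact Hg | apply (ex_series_incr_n f J), ex_series_Rabs, Hft].
    match goal with |- Rabs ?x <= ?y =>
      replace x with (Series (fun k => f (J + k)%nat)) by ring;
      replace y with (Series (fun k => g (J + k)%nat)) by ring end.
    eapply Rle_trans; [apply Series_Rabs, Hft|].
    apply Series_le; [|exact Hgt]. intros k; split; [apply Rabs_pos|apply Hf]. }
  apply is_lim_seq_spec. intros eps.
  pose proof (is_lim_seq_rsum_series g Hg) as Hl. apply is_lim_seq_spec in Hl.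
  assert (He : 0 < eps / 3) by (pose proof (cond_pos eps); lra).
  destruct (Hl (mkposreal _ He)) as [J HJ]. specialize (HJ J (Nat.le_refl J)). simpl in HJ.
  pose proof (is_lim_seq_rsum F G J HF) as Hs. apply is_lim_seq_spec in Hs.
  destruct (Hs (mkposreal _ He)) as [M HM].
  exists M. intros n Hn. specialize (HM n Hn). simpl in HM.
  pose proof (Htail (F n) J (Hb n)) as H1. pose proof (Htail G J HG) as H2.
  apply Rabs_def2 in HJ. apply Rabs_def2 in HM.
  apply Rabs_le_between in H1. apply Rabs_le_between in H2.
  apply Rabs_def1; lra.
Qed.

(** * Bounds and limits of the individual logarithms *)

(** With [q = exp (- u)], the inequality [1 + v <= exp v] at [v = q / (1 - q)] gives
    [- ln (1 - q) <= q / (1 - q)]. The denominator is then frozen at [u0], which leaves a geometric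
    bound. *)
Lemma ln_one_minus_exp_bound (u0 u : R) : 0 < u0 <= u ->
  Rabs (ln (1 - exp (- u))) <= exp (- u) / (1 - exp (- u0)).
Proof.
  intros [H0 H1].
  assert (Hq0 : exp (- u0) < 1) by (rewrite <- exp_0; apply exp_increasing; lra).
  assert (Hq : exp (- u) <= exp (- u0)) by (destruct H1; [left; apply exp_increasing; lra|subst; lra]).
  pose proof (exp_pos (- u)) as Hp. set (q := exp (- u)) in *. set (q0 := exp (- u0)) in *.
  assert (Hle : q / (1 - q) <= q / (1 - q0)).
  { apply Rmult_le_compat_l; [lra|]. apply Rinv_le_contravar; lra. }
  assert (Hneg : ln (1 - q) <= 0) by (rewrite <- ln_1; apply ln_le; lra).
  rewrite Rabs_left1 by exact Hneg.
  eapply Rle_trans; [|exact Hle].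
  apply Ropp_le_cancel. rewrite Ropp_involutive.
  rewrite <- (ln_exp (- (q / (1 - q)))). apply ln_le; [apply exp_pos|].
  assert (HE : / (1 - q) <= exp (q / (1 - q))).
  { eapply Rle_trans; [|apply exp_ineq1_le]. apply Req_le. field; lra. }
  apply Rinv_le_contravar in HE; [|apply Rinv_0_lt_compat; lra].
  rewrite Rinv_inv in HE. rewrite exp_Ropp. exact HE.
Qed.

(** Write [sin y] through the half angle [z = y / 2]: there [z cos z <= sin z] and
    [cos^2 z >= 1/2]. *)
Lemma sin_ge_half (y : R) : 0 <= y <= PI / 2 -> y / 2 <= sin y.
Proof.
  intros Hy. pose proof PI_RGT_0.
  set (f := fun x => sin x - x * cos x).
  assert (Hf : forall z, 0 <= z <= PI / 4 -> z * cos z <= sin z).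
  { intros z Hz. destruct (MVT_gen f 0 z (fun x => x * sin x)) as [c [Hc He]].
    - intros x _. unfold f. auto_derive; [exact I|ring].
    - intros x _. apply continuity_pt_filterlim. apply (ex_derive_continuous f).
      unfold f. auto_derive. exact I.
    - rewrite Rmin_left, Rmax_right in Hc by lra.
      assert (0 <= sin c) by (apply sin_ge_0; lra).
      unfold f in He. rewrite sin_0 in He.
      assert (0 <= c * sin c) by nra.
      assert (0 <= c * sin c * (z - 0)) by nra. lra. }
  specialize (Hf (y / 2) ltac:(lra)).
  replace y with (2 * (y / 2)) at 2 by field. rewrite sin_2a.
  assert (Hc : cos (PI / 4) <= cos (y / 2)) by (apply cos_decr_1; lra).
  rewrite cos_PI4 in Hc.
  assert (Hc2 : 1 / 2 <= cos (y / 2) ^ 2).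
  { assert (Hq : (1 / sqrt 2) ^ 2 = 1 / 2).
    { unfold Rdiv. rewrite Rpow_mult_distr, pow_inv, pow2_sqrt by lra. lra. }
    rewrite <- Hq. apply pow_incr. split; [|exact Hc].
    apply Rlt_le, Rdiv_lt_0_compat; [lra|]. apply sqrt_lt_R0; lra. }
  assert (H0 : 0 <= cos (y / 2)).
  { apply cos_ge_0; lra. }
  apply Rle_trans with (2 * (y / 2 * cos (y / 2)) * cos (y / 2)).
  - replace (2 * (y / 2 * cos (y / 2)) * cos (y / 2)) with (y * cos (y / 2) ^ 2) by field. nra.
  - apply Rmult_le_compat_r; [exact H0|]. lra.
Qed.

(** By the mean value theorem, since the derivative of [arcsinh] on [[0, s]] is at least its value
    at [s]. *)
Lemma arcsinh_ge_linear (s z : R) : 0 <= z <= s -> z / sqrt (s ^ 2 + 1) <= arcsinh z.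
Proof.
  intros [H0 H1].
  destruct (MVT_gen arcsinh 0 z (fun x => / sqrt (x ^ 2 + 1))) as [c [Hc He]].
  - intros x _. apply is_derive_Reals, derivable_pt_lim_arcsinh.
  - intros x _. apply derivable_continuous_pt. eexists. apply derivable_pt_lim_arcsinh.
  - rewrite Rmin_left, Rmax_right in Hc by lra. rewrite arcsinh_0 in He.
    replace (arcsinh z) with (/ sqrt (c ^ 2 + 1) * z) by lra.
    unfold Rdiv. rewrite Rmult_comm. apply Rmult_le_compat_r; [exact H0|].
    apply Rinv_le_contravar; [apply sqrt_lt_R0; nra|]. apply sqrt_le_1; nra.
Qed.

(** A rate independent of [n] at which the exponents in [log_factor] grow with [j] on the lower half
    of the range; it supplies the dominating geometric series. *)
Definition decay (s : R) : R := PI * s / sqrt (s ^ 2 + 1).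

Lemma decay_pos (s : R) : 0 < s -> 0 < decay s.
Proof.
  intros Hs. pose proof PI_RGT_0. apply Rdiv_lt_0_compat; [nra|]. apply sqrt_lt_R0; nra.
Qed.

Lemma asfrac_ge_linear (s : R) (n j : nat) : 0 < s -> (2 * j <= 2 ^ n)%nat ->
  decay s * INR j <= 2 * (INR (2 ^ n) * asfrac s n j).
Proof.
  intros Hs Hj. pose proof (INR_two_pow_pos n) as Hp. pose proof PI_RGT_0 as HPI.
  apply le_INR in Hj. rewrite mult_INR in Hj; simpl (INR 2) in Hj.
  pose proof (pos_INR j) as Hj0.
  assert (Hy : 0 <= PI * INR j / INR (2 ^ n) <= PI / 2).
  { split; [apply Rdiv_le_0_compat; [apply Rmult_le_pos; lra|exact Hp]|].
    apply Rmult_le_reg_r with (INR (2 ^ n)); [exact Hp|].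
    unfold Rdiv at 1. rewrite Rmult_assoc, Rinv_l by lra. nra. }
  pose proof (sin_ge_half _ Hy) as Hsin.
  pose proof (SIN_bound (PI * INR j / INR (2 ^ n))) as Hs1.
  assert (Hq : 0 < / sqrt (s ^ 2 + 1)) by (apply Rinv_0_lt_compat, sqrt_lt_R0; nra).
  pose proof (arcsinh_ge_linear s (s * sinfrac n j)) as Ha. fold (asfrac s n j) in Ha.
  assert (Hr : 0 <= s * sinfrac n j <= s) by (unfold sinfrac; nra).
  specialize (Ha Hr). unfold Rdiv in Ha.
  assert (H1 : s * (PI * INR j / INR (2 ^ n) / 2) * / sqrt (s ^ 2 + 1) <= asfrac s n j).
  { eapply Rle_trans; [|exact Ha]. apply Rmult_le_compat_r; [lra|].
    apply Rmult_le_compat_l; [lra|]. exact Hsin. }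
  replace (decay s * INR j) with
    (2 * (INR (2 ^ n) * (s * (PI * INR j / INR (2 ^ n) / 2) * / sqrt (s ^ 2 + 1))))
    by (unfold decay; field; split; [apply Rgt_not_eq, sqrt_lt_R0; nra|lra]).
  apply Rmult_le_compat_l; [lra|]. apply Rmult_le_compat_l; lra.
Qed.

Lemma INR_two_pow (n : nat) : INR (2 ^ n) = 2 ^ n.
Proof. rewrite pow_INR. reflexivity. Qed.

Lemma is_lim_seq_over_pow2 (a : R) : is_lim_seq (fun n => a / INR (2 ^ n)) 0.
Proof.
  apply (is_lim_seq_ext (fun n => a * (/ 2) ^ n)).
  - intros n. rewrite INR_two_pow, pow_inv. reflexivity.
  - replace (Finite 0) with (Rbar_mult a 0) by (simpl; f_equal; ring).
    apply is_lim_seq_scal_l. apply is_lim_seq_geom. rewrite Rabs_right; lra.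
Qed.

Lemma asfrac_asin_sinh (s : R) (n j : nat) : asfrac s n j = asin_sinh s (INR j / INR (2 ^ n)).
Proof. unfold asfrac, sinfrac, asin_sinh. do 3 f_equal. unfold Rdiv; ring. Qed.

(** A difference quotient of [asin_sinh s] at 0, where the derivative is [pi s], along the
    increments [j / 2^n]. *)
Lemma asfrac_lim (s : R) (j : nat) :
  is_lim_seq (fun n => INR (2 ^ n) * asfrac s n j) (PI * s * INR j).
Proof.
  pose proof (is_lim_seq_over_pow2 (INR j)) as Hlim. apply is_lim_seq_spec in Hlim.
  destruct (Nat.eq_dec j 0) as [->|Hj0].
  { apply (is_lim_seq_ext (fun _ => 0)).
    - intros n. unfold asfrac, sinfrac. simpl (INR 0).
      replace (PI * 0 / INR (2 ^ n)) with 0 by (unfold Rdiv; ring).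
      rewrite sin_0, Rmult_0_r, arcsinh_0. ring.
    - simpl (INR 0). rewrite Rmult_0_r. apply is_lim_seq_const. }
  assert (Hj : 0 < INR j) by (apply lt_0_INR; lia).
  assert (Hd : derivable_pt_lim (asin_sinh s) 0 (PI * s)).
  { apply is_derive_Reals.
    pose proof (asin_sinh_deriv s 0) as H. cbv beta in H.
    replace (PI * 0) with 0 in H by ring. rewrite sin_0, cos_0 in H.
    replace (1 + s ^ 2 * 0 ^ 2) with 1 in H by ring. rewrite sqrt_1 in H.
    replace (PI * s) with (s * PI * 1 * / 1) by field. exact H. }
  apply is_lim_seq_spec. intros eps.
  assert (He : 0 < eps / INR j) by (apply Rdiv_lt_0_compat; [apply cond_pos|exact Hj]).
  destruct (Hd _ He) as [del Hdel].
  destruct (Hlim del) as [M HM]. exists M. intros n Hn.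
  specialize (HM n Hn). rewrite Rminus_0_r in HM.
  pose proof (INR_two_pow_pos n) as Hp.
  assert (Hh : 0 < INR j / INR (2 ^ n)) by (apply Rdiv_lt_0_compat; lra).
  specialize (Hdel (INR j / INR (2 ^ n)) (Rgt_not_eq _ _ Hh) HM).
  rewrite Rplus_0_l in Hdel.
  assert (H0 : asin_sinh s 0 = 0).
  { unfold asin_sinh. rewrite Rmult_0_r, sin_0, Rmult_0_r. apply arcsinh_0. }
  rewrite H0, Rminus_0_r, <- asfrac_asin_sinh in Hdel.
  replace (INR (2 ^ n) * asfrac s n j - PI * s * INR j)
    with (INR j * (asfrac s n j / (INR j / INR (2 ^ n)) - PI * s)) by (field; lra).
  rewrite Rabs_mult, (Rabs_right (INR j)) by lra.
  replace (pos eps) with (INR j * (eps / INR j)) by (field; lra).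
  apply Rmult_lt_compat_l; assumption.
Qed.

(** * The limit of the combined sums for [N] and [2 N] *)

Lemma exp_pow_nat (x : R) (n : nat) : exp x ^ n = exp (INR n * x).
Proof.
  induction n as [|n IH]; [simpl; rewrite Rmult_0_l, exp_0; reflexivity|].
  rewrite S_INR; simpl. rewrite IH, <- exp_plus. f_equal; ring.
Qed.

Definition log_factor (s : R) (n j : nat) : R :=
  ln (1 - exp (- (2 * (INR (2 ^ n) * asfrac s n j)))).

(** The logarithm of the Euler product in [eta]. *)
Definition log_euler (b : R) : R := Series (fun j => ln (1 - exp (- (INR (S j) * b)))).

Lemma asfrac_sym (s : R) (n j : nat) : (j <= 2 ^ n)%nat -> asfrac s n (2 ^ n - j) = asfrac s n j.
Proof.
  intros Hj. unfold asfrac, sinfrac. do 2 f_equal. pose proof (INR_two_pow_pos n).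
  rewrite minus_INR by exact Hj. rewrite <- sin_PI_x. f_equal. field; lra.
Qed.

Lemma log_factor_bound (s : R) (n j : nat) : 0 < s -> (0 < j)%nat -> (2 * j <= 2 ^ n)%nat ->
  Rabs (log_factor s n j) <= exp (- decay s) ^ j / (1 - exp (- decay s)).
Proof.
  intros Hs H0 Hj. pose proof (asfrac_ge_linear s n j Hs Hj) as H.
  pose proof (decay_pos s Hs) as Hd. apply le_INR in H0; simpl in H0.
  assert (Hu : 0 < decay s <= 2 * (INR (2 ^ n) * asfrac s n j)) by (split; [|nra]; lra).
  eapply Rle_trans; [apply (ln_one_minus_exp_bound _ _ Hu)|].
  assert (exp (- decay s) < 1) by (rewrite <- exp_0; apply exp_increasing; lra).
  apply Rmult_le_compat_r; [left; apply Rinv_0_lt_compat; lra|].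
  rewrite exp_pow_nat.
  destruct (Rle_lt_or_eq_dec _ _ H) as [Hl|Hl]; [left; apply exp_increasing|right; f_equal]; lra.
Qed.

Lemma log_factor_lim (s : R) (j : nat) : 0 < s -> (0 < j)%nat ->
  is_lim_seq (fun n => log_factor s n j) (ln (1 - exp (- (INR j * (2 * PI * s))))).
Proof.
  intros Hs Hj. apply lt_INR in Hj; simpl in Hj. pose proof PI_RGT_0.
  assert (0 < PI * s) by nra.
  assert (Hlt : exp (- (INR j * (2 * PI * s))) < 1) by (rewrite <- exp_0; apply exp_increasing; nra).
  unfold log_factor.
  replace (INR j * (2 * PI * s)) with (2 * (PI * s * INR j)) in * by ring.
  apply (is_lim_seq_continuous (fun x => ln (1 - exp (- (2 * x))))
           (fun n => INR (2 ^ n) * asfrac s n j) (PI * s * INR j)).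
  2: apply asfrac_lim.
  - apply continuity_pt_filterlim.
    apply (ex_derive_continuous (fun x => ln (1 - exp (- (2 * x))))).
    auto_derive. lra.
Qed.

Lemma ex_series_decay (s C : R) : 0 < s ->
  ex_series (fun j => exp (- decay s) ^ (S j) / C).
Proof.
  intros Hs. pose proof (decay_pos s Hs).
  apply (ex_series_ext (fun j => exp (- decay s) ^ j * (exp (- decay s) / C))).
  - intros j; simpl; unfold Rdiv; ring.
  - apply (ex_series_scal_r (exp (- decay s) / C)). apply ex_series_geom.
    rewrite Rabs_right by (apply Rle_ge, Rlt_le, exp_pos).
    rewrite <- exp_0. apply exp_increasing; lra.
Qed.

(** The range is symmetric under [j -> 2^(n+1) - j], so the sum is twice its lower half plus the
    middle term. The half converges by dominated convergence and the middle term tends to 0. The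
    factor 2 in the limit counts the two ends. *)
Lemma is_lim_seq_rsum_log_factor (s : R) : 0 < s ->
  is_lim_seq (fun n => rsum (fun j => log_factor s (S n) (S j)) (2 ^ S n - 1))
    (2 * log_euler (2 * PI * s)).
Proof.
  intros Hs.
  set (C := 1 - exp (- decay s)).
  (* The lower half, extended by 0 to a series; the middle index [2^n] is left out. *)
  set (F := fun n j => if Compare_dec.lt_dec (S j) (2 ^ n) then log_factor s (S n) (S j) else 0).
  assert (HF : is_lim_seq (fun n => Series (F n)) (log_euler (2 * PI * s))).
  { apply tannery with (g := fun j => exp (- decay s) ^ S j / C).
    - intros j.
      apply (is_lim_seq_ext_loc (fun n => log_factor s (S n) (S j))).
      + exists (S (S j)). intros n Hn. unfold F.
        destruct (Compare_dec.lt_dec (S j) (2 ^ n)) as [_|Hc]; [reflexivity|].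
        pose proof (Nat.pow_gt_lin_r 2 n ltac:(lia)). lia.
      + apply (is_lim_seq_incr_1 (fun n => log_factor s n (S j))).
        apply log_factor_lim; [exact Hs|lia].
    - intros n j. unfold F. destruct (Compare_dec.lt_dec (S j) (2 ^ n)) as [H|H].
      + apply log_factor_bound; [exact Hs|lia|simpl; lia].
      + rewrite Rabs_R0. apply Rdiv_le_0_compat; [apply pow_le, Rlt_le, exp_pos|].
        unfold C. pose proof (decay_pos s Hs).
        enough (exp (- decay s) < 1) by lra. rewrite <- exp_0; apply exp_increasing; lra.
    - apply ex_series_decay; exact Hs. }
  assert (HM : is_lim_seq (fun n => log_factor s (S n) (2 ^ n)) 0).
  { apply is_lim_seq_abs_0.
    apply (is_lim_seq_le_le (fun _ => 0) _ (fun n => exp (- decay s) ^ n / C)).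
    - intros n. split; [apply Rabs_pos|].
      pose proof (Nat.pow_gt_lin_r 2 n ltac:(lia)) as Hn.
      eapply Rle_trans; [apply log_factor_bound; [exact Hs|lia|simpl; lia]|].
      pose proof (decay_pos s Hs).
      assert (exp (- decay s) < 1) by (rewrite <- exp_0; apply exp_increasing; lra).
      apply Rmult_le_compat_r; [left; apply Rinv_0_lt_compat; unfold C; lra|].
      pose proof (exp_pos (- decay s)).
      replace (2 ^ n)%nat with (n + (2 ^ n - n))%nat by lia. rewrite pow_add.
      rewrite <- (Rmult_1_r (exp (- decay s) ^ n)) at 2.
      apply Rmult_le_compat_l; [apply pow_le; lra|].
      rewrite <- (pow1 (2 ^ n - n)). apply pow_incr; lra.
    - apply is_lim_seq_const.
    - pose proof (decay_pos s Hs). pose proof (exp_pos (- decay s)).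
      replace (Finite 0) with (Rbar_mult 0 (/ C)) by (simpl; f_equal; ring).
      apply is_lim_seq_scal_r. apply is_lim_seq_geom. rewrite Rabs_right by lra.
      rewrite <- exp_0; apply exp_increasing; lra. }
  apply (is_lim_seq_ext (fun n => 2 * Series (F n) + log_factor s (S n) (2 ^ n))).
  - intros n. pose proof (Nat.pow_gt_lin_r 2 n ltac:(lia)) as Hn.
    rewrite (Series_finite (F n) (2 ^ n - 1)).
    2:{ intros k Hk. unfold F. destruct (Compare_dec.lt_dec (S k) (2 ^ n)); [lia|reflexivity]. }
    rewrite (rsum_ext (F n) (fun j => log_factor s (S n) (S j))).
    2:{ intros k Hk. unfold F. destruct (Compare_dec.lt_dec (S k) (2 ^ n)); [reflexivity|lia]. }
    replace (2 ^ S n - 1)%nat with ((2 ^ n - 1) + S (2 ^ n - 1))%nat by (simpl; lia).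
    rewrite rsum_add, rsum_S_left.
    rewrite (rsum_rev (fun k => log_factor s (S n) (S (2 ^ n - 1 + S k)))).
    rewrite (rsum_ext (fun k => log_factor s (S n) (S (2 ^ n - 1 + S (2 ^ n - 1 - S k))))
               (fun j => log_factor s (S n) (S j))).
    2:{ intros k Hk. unfold log_factor.
        rewrite <- (asfrac_sym s (S n) (S k)) by (simpl; lia).
        do 6 f_equal. f_equal. simpl. lia. }
    replace (S (2 ^ n - 1 + 0)) with (2 ^ n)%nat by lia. ring.
  - rewrite <- (Rplus_0_r (2 * log_euler (2 * PI * s))).
    apply is_lim_seq_plus'; [|exact HM].
    apply (is_lim_seq_scal_l _ 2 (log_euler (2 * PI * s)) HF).
Qed.

Lemma sinh_log_sum_split (s : R) (n : nat) :
  sinh_log_sum s n = 2 * INR (2 ^ n) * rsum (fun j => asin_sinh s (INR j / INR (2 ^ n))) (2 ^ n)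
    + 2 * rsum (fun j => log_factor s n (S j)) (2 ^ n - 1).
Proof.
  unfold sinh_log_sum, sinh_log.
  rewrite rsum_plus, !rsum_scal. f_equal.
  replace (2 ^ n)%nat with (S (2 ^ n - 1)) at 4 by (pose proof (Nat.pow_nonzero 2 n); lia).
  rewrite rsum_S_left. simpl (INR 0).
  replace (0 / INR (2 ^ n)) with 0 by (unfold Rdiv; ring).
  unfold asin_sinh at 1. rewrite Rmult_0_r, sin_0, Rmult_0_r, arcsinh_0, Rplus_0_l, Rmult_assoc.
  do 2 f_equal. apply rsum_ext; intros k _. apply asfrac_asin_sinh.
Qed.

(** Weighting by 1 and -4 turns the [arcsinh] parts into the refinement error of the trapezoidal
    rule, with limit [pi s]. The logarithmic parts contribute [(2 - 8) * 2 = -12] times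
    [log_euler]. *)
Lemma sinh_log_sum_lim (s : R) : 0 < s ->
  is_lim_seq (fun n => sinh_log_sum s (S (S n)) - 4 * sinh_log_sum s (S n))
    (PI * s - 12 * log_euler (2 * PI * s)).
Proof.
  intros Hs. destruct (asin_sinh_refinement s Hs) as [K HK].
  set (D := fun n => 4 * INR (2 ^ n) * (rsum (fun j => asin_sinh s (INR j / INR (2 ^ S n))) (2 ^ S n)
                - 2 * rsum (fun j => asin_sinh s (INR j / INR (2 ^ n))) (2 ^ n))).
  assert (HD : is_lim_seq D (PI * s)).
  { apply is_lim_seq_ext with (fun n => (D n - PI * s) + PI * s); [intros; ring|].
    replace (Finite (PI * s)) with (Finite (0 + PI * s)) by (f_equal; ring).
    apply is_lim_seq_plus'; [|apply is_lim_seq_const].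
    apply is_lim_seq_abs_0.
    apply (is_lim_seq_le_le (fun _ => 0) _ (fun n => K / INR (2 ^ n))).
    - intros n. split; [apply Rabs_pos|]. apply HK.
      pose proof (Nat.pow_nonzero 2 n). lia.
    - apply is_lim_seq_const.
    - apply is_lim_seq_over_pow2. }
  pose proof (is_lim_seq_rsum_log_factor s Hs) as HV.
  set (V := fun n => rsum (fun j => log_factor s (S n) (S j)) (2 ^ S n - 1)) in HV.
  apply (is_lim_seq_ext (fun n => D (S n) + (2 * V (S n) + - (8 * V n)))).
  - intros n. rewrite !sinh_log_sum_split. unfold D, V.
    replace (INR (2 ^ S (S n))) with (2 * INR (2 ^ S n))
      by (rewrite (Nat.pow_succ_r' 2 (S n)), mult_INR; reflexivity). ring.
  - replace (PI * s - 12 * log_euler (2 * PI * s)) with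
      (PI * s + (2 * (2 * log_euler (2 * PI * s)) + - (8 * (2 * log_euler (2 * PI * s))))) by ring.
    apply is_lim_seq_plus'; [apply -> is_lim_seq_incr_1; exact HD|].
    apply is_lim_seq_plus'.
    + apply (is_lim_seq_scal_l _ 2 (2 * log_euler (2 * PI * s))).
      apply -> is_lim_seq_incr_1; exact HV.
    + apply (is_lim_seq_opp _ (8 * (2 * log_euler (2 * PI * s)))).
      apply (is_lim_seq_scal_l _ 8 (2 * log_euler (2 * PI * s))). exact HV.
Qed.

(** * The modular law of [eta] *)

(** In the combination for [2 N] and [N], the inversion formula gives [2 ((4 N^2 - 1) - 4 (N^2 - 1))
    ln s = 6 ln s], constant in [N]. *)
Lemma log_euler_modular (s : R) : 0 < s ->
  (PI * s - 12 * log_euler (2 * PI * s)) - (PI * / s - 12 * log_euler (2 * PI * / s)) = 6 * ln s.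
Proof.
  intros Hs. pose proof (Rinv_0_lt_compat s Hs) as Hi.
  pose proof (sinh_log_sum_lim s Hs) as H1. pose proof (sinh_log_sum_lim (/ s) Hi) as H2.
  pose proof (is_lim_seq_minus' _ _ _ _ H1 H2) as H.
  assert (HE : is_lim_seq (fun _ => 6 * ln s) (PI * s - 12 * log_euler (2 * PI * s) -
         (PI * / s - 12 * log_euler (2 * PI * / s)))).
  { eapply is_lim_seq_ext; [|exact H]. intros n. cbv beta.
    pose proof (sinh_log_sum_inv s (S n) Hs) as E1.
    pose proof (sinh_log_sum_inv s (S (S n)) Hs) as E2.
    replace (INR (2 ^ S (S n))) with (2 * INR (2 ^ S n)) in E2
      by (rewrite (Nat.pow_succ_r' 2 (S n)), mult_INR; reflexivity).
    lra. }
  apply is_lim_seq_unique in HE. rewrite Lim_seq_const in HE. injection HE; auto.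
Qed.

Lemma ex_series_log_euler (b : R) : 0 < b ->
  ex_series (fun j => ln (1 - exp (- (INR (S j) * b)))).
Proof.
  intros Hb.
  apply (ex_series_le (fun j => ln (1 - exp (- (INR (S j) * b))))
           (fun j => exp (- b) ^ j * (exp (- b) / (1 - exp (- b))))).
  - intros j. unfold norm; simpl. unfold abs; simpl.
    assert (Hj : 1 <= INR (S j)) by (rewrite S_INR; pose proof (pos_INR j); lra).
    assert (Hjb : 0 < b <= INR (S j) * b) by (split; [exact Hb|nra]).
    eapply Rle_trans; [apply (ln_one_minus_exp_bound b _ Hjb)|].
    apply Req_le. unfold Rdiv. rewrite <- Rmult_assoc. f_equal.
    rewrite exp_pow_nat, <- exp_plus. f_equal. fold (INR (S j)). rewrite S_INR. ring.
  - apply (ex_series_scal_r (exp (- b) / (1 - exp (- b)))). apply ex_series_geom.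
    rewrite Rabs_right by (apply Rle_ge, Rlt_le, exp_pos).
    rewrite <- exp_0. apply exp_increasing; lra.
Qed.

Lemma eta_log_euler (b : R) : 0 < b -> eta b = exp (- b / 24 + log_euler b).
Proof.
  intros Hb. unfold eta. rewrite exp_plus. f_equal.
  assert (Hp : forall n, eta_pprod b n = exp (rsum (fun j => ln (1 - exp (- (INR (S j) * b)))) n)).
  { induction n as [|n IH]; [simpl; rewrite exp_0; reflexivity|].
    cbn [rsum eta_pprod]. rewrite exp_plus, <- IH, exp_ln; [do 2 f_equal; f_equal; ring|].
    assert (Hn : 1 <= INR (S n)) by (rewrite S_INR; pose proof (pos_INR n); lra).
    enough (exp (- (INR (S n) * b)) < 1) by lra.
    rewrite <- exp_0. apply exp_increasing. nra. }
  assert (HL : is_lim_seq (eta_pprod b) (exp (log_euler b))).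
  { apply (is_lim_seq_ext (fun n => exp (rsum (fun j => ln (1 - exp (- (INR (S j) * b)))) n)));
      [intros; symmetry; apply Hp|].
    apply (is_lim_seq_continuous exp); [apply derivable_continuous_pt, derivable_pt_exp|].
    apply is_lim_seq_rsum_series, ex_series_log_euler, Hb. }
  rewrite (is_lim_seq_unique _ _ HL). reflexivity.
Qed.

Lemma eta_pos (b : R) : 0 < b -> 0 < eta b.
Proof. intros Hb. rewrite eta_log_euler by exact Hb. apply exp_pos. Qed.

(** The previous identity at [s = b / (2 pi)]; dividing by 12 leaves [ln s / 2], hence the square
    root. *)
Theorem eta_modular (b : R) : 0 < b -> eta (4 * PI ^ 2 / b) = sqrt (b / (2 * PI)) * eta b.
Proof.
  intros Hb. pose proof PI_RGT_0 as HPI.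
  assert (Hs : 0 < b / (2 * PI)) by (apply Rdiv_lt_0_compat; lra).
  assert (Hb' : 0 < 4 * PI ^ 2 / b) by (apply Rdiv_lt_0_compat; [nra|lra]).
  pose proof (log_euler_modular _ Hs) as H.
  replace (2 * PI * (b / (2 * PI))) with b in H by (field; lra).
  replace (2 * PI * / (b / (2 * PI))) with (4 * PI ^ 2 / b) in H by (field; lra).
  replace (PI * (b / (2 * PI))) with (b / 2) in H by (field; lra).
  replace (PI * / (b / (2 * PI))) with ((4 * PI ^ 2 / b) / 2) in H by (field; lra).
  rewrite !eta_log_euler by assumption.
  rewrite <- (exp_ln (sqrt (b / (2 * PI)))) by (apply sqrt_lt_R0; exact Hs).
  rewrite <- exp_plus. f_equal.
  assert (Hln : ln (b / (2 * PI)) = 2 * ln (sqrt (b / (2 * PI)))).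
  { rewrite <- (sqrt_sqrt (b / (2 * PI))) at 1 by lra.
    rewrite ln_mult by (apply sqrt_lt_R0; exact Hs). ring. }
  lra.
Qed.

(** * Light and heavy parts of the reduced partition function *)

Lemma Series_single (a : nat -> R) (k0 : nat) :
  (forall k, k <> k0 -> a k = 0) -> Series a = a k0.
Proof.
  intros H. rewrite (Series_finite a (S k0)) by (intros k Hk; apply H; lia).
  simpl. rewrite (rsum_ext a (fun _ => 0)) by (intros k Hk; apply H; lia).
  rewrite rsum_const; ring.
Qed.

Lemma ex_series_single (a : nat -> R) (k0 : nat) :
  (forall k, k <> k0 -> a k = 0) -> ex_series a.
Proof.
  intros H. apply (ex_series_incr_n a (S k0)). exists 0.
  apply (is_series_ext (fun _ => 0)).
  - intros k; symmetry; apply H; lia.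
  - change (is_lim_seq (sum_n (fun _ => 0)) 0).
    apply (is_lim_seq_ext (fun _ => 0)); [|apply is_lim_seq_const].
    intros k; rewrite <- rsum_sum_n, rsum_const; ring.
Qed.

Lemma exp_neg_lt_1 (b : R) : 0 < b -> exp (- b) < 1.
Proof. intros Hb. rewrite <- exp_0. apply exp_increasing; lra. Qed.

Definition ZVir_reduced (c : R) (spec : spectrum) (bL bR : R) : R :=
  ZVir c spec bL bR * exp (- ((c - 1) / 24 * (bL + bR))).

Definition vacuum_term (spec : spectrum) (bL bR : R) (k : nat) : R :=
  match spec k with
  | None => 0
  | Some (h, hb) =>
      if Req_EM_T h 0 then
        if Req_EM_T hb 0 then (1 - exp (- bL)) * (1 - exp (- bR)) else 0
      else 0
  end.

Lemma chi_reduced (c h b : R) : 0 < b ->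
  chi c h b * eta b * exp (- ((c - 1) / 24 * b)) =
  if Req_EM_T h 0 then 1 - exp (- b) else exp (- h * b).
Proof.
  intros Hb. unfold chi. pose proof (eta_pos b Hb).
  set (r := if Req_EM_T h 0 then _ else _).
  rewrite (exp_Ropp ((c - 1) / 24 * b)).
  pose proof (exp_pos ((c - 1) / 24 * b)). field. lra.
Qed.

Section CFT.

Variables (alpha c : R) (spec : spectrum).
Hypothesis alpha_bound : 0 < alpha <= 1.
Hypothesis c_gt_1 : 1 < c.
Hypothesis cft : is_CFT c spec.

Lemma threshold_pos : 0 < alpha * (c - 1) / 24.
Proof. apply Rdiv_lt_0_compat; [apply Rmult_lt_0_compat|]; lra. Qed.

(** Each primary falls into exactly one class: vacuum, current, light with both weights positive, or
    heavy. The positive threshold keeps vacuum and currents out of the heavy class. *)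
Lemma Z_term_split (bL bR : R) (k : nat) : 0 < bL -> 0 < bR ->
  Z_term c spec bL bR k * (eta bL * eta bR * exp (- ((c - 1) / 24 * (bL + bR))))
  = vacuum_term spec bL bR k + (ZL_term alpha c spec bL bR k + ZH_term alpha c spec bL bR k).
Proof.
  intros HL HR. pose proof threshold_pos as Ht.
  unfold Z_term, vacuum_term, ZL_term, ZH_term.
  destruct (spec k) as [[h hb]|] eqn:E; [|ring].
  destruct cft as [Hnn _]. destruct (Hnn _ _ _ E) as [Hh Hhb].
  transitivity ((chi c h bL * eta bL * exp (- ((c - 1) / 24 * bL))) *
                (chi c hb bR * eta bR * exp (- ((c - 1) / 24 * bR)))).
  { replace (- ((c - 1) / 24 * (bL + bR)))
      with (- ((c - 1) / 24 * bL) + - ((c - 1) / 24 * bR)) by ring.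
    rewrite exp_plus. ring. }
  rewrite !chi_reduced by assumption.
  set (T := alpha * (c - 1) / 24) in *.
  destruct (Req_EM_T h 0) as [E1|E1]; destruct (Req_EM_T hb 0) as [E2|E2]; subst;
  (destruct (Rlt_dec 0 (Rmin _ _)) as [Hm|Hm];
   [assert (Hm' := Hm); apply Rmin_Rgt in Hm'|]); try lra;
  repeat match goal with
  | |- context [Rlt_dec ?a ?b] => destruct (Rlt_dec a b)
  | |- context [Rle_dec ?a ?b] => destruct (Rle_dec a b)
  end; try lra.
  all: try (exfalso; apply Hm; apply Rmin_glb_lt; lra).
  all: try (replace (- h * bL - hb * bR) with (- h * bL + - hb * bR) by ring; rewrite exp_plus; lra).
  all: exfalso; unfold Rmin in *; destruct (Rle_dec h hb); lra.
Qed.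

Lemma vacuum_term_zero (k0 : nat) (bL bR : R) :
  (forall k, spec k = Some (0, 0) -> k = k0) ->
  forall k, k <> k0 -> vacuum_term spec bL bR k = 0.
Proof.
  intros Hu k Hk. unfold vacuum_term. destruct (spec k) as [[h hb]|] eqn:E; [|reflexivity].
  destruct (Req_EM_T h 0); [|reflexivity]. destruct (Req_EM_T hb 0); [|reflexivity].
  subst. exfalso; auto.
Qed.

Lemma ZL_term_nonneg (bL bR : R) (k : nat) : 0 < bL -> 0 < bR ->
  0 <= ZL_term alpha c spec bL bR k.
Proof.
  intros HL HR. unfold ZL_term. destruct (spec k) as [[h hb]|]; [|lra].
  pose proof (exp_neg_lt_1 bL HL). pose proof (exp_neg_lt_1 bR HR).
  repeat match goal with |- context [Rlt_dec ?a ?b] => destruct (Rlt_dec a b) end;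
    try lra; try (left; apply exp_pos); apply Rmult_le_pos; try (left; apply exp_pos); lra.
Qed.

Lemma ZH_term_nonneg (bL bR : R) (k : nat) : 0 <= ZH_term alpha c spec bL bR k.
Proof.
  unfold ZH_term. destruct (spec k) as [[h hb]|]; [|lra].
  repeat match goal with |- context [Rle_dec ?a ?b] => destruct (Rle_dec a b) end;
    try lra; left; apply exp_pos.
Qed.

Lemma vacuum_term_nonneg (bL bR : R) (k : nat) : 0 < bL -> 0 < bR ->
  0 <= vacuum_term spec bL bR k.
Proof.
  intros HL HR. unfold vacuum_term. destruct (spec k) as [[h hb]|]; [|lra].
  pose proof (exp_neg_lt_1 bL HL). pose proof (exp_neg_lt_1 bR HR).
  destruct (Req_EM_T h 0); [|lra]. destruct (Req_EM_T hb 0); [|lra]. apply Rmult_le_pos; lra.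
Qed.

(** All three parts of a term are nonnegative, so each is dominated by the convergent series of the
    full terms. *)
Lemma ex_series_split (bL bR : R) : 0 < bL -> 0 < bR ->
  ex_series (ZL_term alpha c spec bL bR) /\ ex_series (ZH_term alpha c spec bL bR).
Proof.
  intros HL HR.
  destruct cft as [_ [_ [_ [_ [Hex _]]]]].
  pose proof (ex_series_scal_r (eta bL * eta bR * exp (- ((c - 1) / 24 * (bL + bR)))) _
                (Hex bL bR HL HR)) as Hs.
  split;
    [refine (ex_series_le (ZL_term alpha c spec bL bR) _ _ Hs)
    |refine (ex_series_le (ZH_term alpha c spec bL bR) _ _ Hs)]; intros k;
    unfold norm; simpl; unfold abs; simpl;
    pose proof (ZL_term_nonneg bL bR k HL HR); pose proof (ZH_term_nonneg bL bR k);
    pose proof (vacuum_term_nonneg bL bR k HL HR);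
    rewrite Z_term_split, Rabs_right by lra; lra.
Qed.

Lemma ZVir_reduced_split (bL bR : R) : 0 < bL -> 0 < bR ->
  ZVir_reduced c spec bL bR = ZL_tilde alpha c spec bL bR + ZH_tilde alpha c spec bL bR.
Proof.
  intros HL HR. destruct (ex_series_split bL bR HL HR) as [EL EH].
  destruct cft as [_ [_ [[k0 [Hk0 Hu]] _]]].
  pose proof (vacuum_term_zero k0 bL bR Hu) as Hv.
  unfold ZVir_reduced, ZVir, Zpart, ZL_tilde, ZH_tilde.
  rewrite !Rmult_assoc, <- Series_scal_r, <- Rmult_assoc.
  rewrite (Series_ext _ _ (fun k => Z_term_split bL bR k HL HR)).
  rewrite Series_plus; [|exact (ex_series_single _ _ Hv)|apply (ex_series_plus _ _ EL EH)].
  rewrite Series_plus by assumption.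
  rewrite (Series_single _ _ Hv). unfold vacuum_term. rewrite Hk0.
  destruct (Req_EM_T 0 0); [|lra]. ring.
Qed.

(** The vacuum contributes a strictly positive amount, which makes the logarithm in [EVir]
    meaningful. *)
Lemma ZL_tilde_pos (bL bR : R) : 0 < bL -> 0 < bR -> 0 < ZL_tilde alpha c spec bL bR.
Proof.
  intros HL HR. unfold ZL_tilde.
  pose proof (exp_neg_lt_1 bL HL). pose proof (exp_neg_lt_1 bR HR).
  assert (H1 : 0 < (1 - exp (- bL)) * (1 - exp (- bR))) by (apply Rmult_lt_0_compat; lra).
  assert (H2 : 0 <= Series (ZL_term alpha c spec bL bR)).
  { replace 0 with (Series (fun _ : nat => 0)).
    - apply Series_le; [|apply (ex_series_split bL bR HL HR)].
      intros k. split; [lra|apply ZL_term_nonneg; assumption].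
    - rewrite (Series_finite _ O); [reflexivity|reflexivity]. }
  lra.
Qed.

Lemma ZH_tilde_nonneg (bL bR : R) : 0 < bL -> 0 < bR -> 0 <= ZH_tilde alpha c spec bL bR.
Proof.
  intros HL HR. unfold ZH_tilde.
  replace 0 with (Series (fun _ : nat => 0)).
  - apply Series_le; [|apply (ex_series_split bL bR HL HR)].
    intros k. split; [lra|apply ZH_term_nonneg].
  - rewrite (Series_finite _ O); [reflexivity|reflexivity].
Qed.

(** [Zpart] is invariant, so the factor comes only from the two [eta] functions; it equals [wgt] at
    the image point. *)
Lemma ZVir_modular (bL bR : R) : 0 < bL -> 0 < bR ->
  ZVir c spec bL bR = wgt (4 * PI ^ 2 / bL, 4 * PI ^ 2 / bR)
                      * ZVir c spec (4 * PI ^ 2 / bL) (4 * PI ^ 2 / bR).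
Proof.
  intros HL HR. pose proof PI_RGT_0.
  destruct cft as [_ [_ [_ [_ [_ Hmod]]]]].
  unfold ZVir. rewrite <- Hmod, !eta_modular by assumption. unfold wgt; cbn [fst snd].
  assert (Hw : sqrt (4 * PI ^ 2 / bL * (4 * PI ^ 2 / bR) / (4 * PI ^ 2))
               * (sqrt (bL / (2 * PI)) * sqrt (bR / (2 * PI))) = 1).
  { assert (0 < bL / (2 * PI)) by (apply Rdiv_lt_0_compat; lra).
    assert (0 < bR / (2 * PI)) by (apply Rdiv_lt_0_compat; lra).
    rewrite <- sqrt_mult_alt by lra. rewrite <- sqrt_mult_alt.
    - rewrite <- sqrt_1. f_equal. field. lra.
    - assert (0 < 4 * PI ^ 2) by nra.
      left. repeat apply Rdiv_lt_0_compat; try lra.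
      apply Rmult_lt_0_compat; apply Rdiv_lt_0_compat; lra. }
  transitivity ((sqrt (4 * PI ^ 2 / bL * (4 * PI ^ 2 / bR) / (4 * PI ^ 2))
               * (sqrt (bL / (2 * PI)) * sqrt (bR / (2 * PI)))) *
               (Zpart c spec bL bR * eta bL * eta bR)); [rewrite Hw; ring|ring].
Qed.

(* [u] is the modular image of [q]. Heavy weights exceed [alpha (c-1)/24], so lowering
   [b] to [u] multiplies each heavy term by at least [exp (alpha (c-1)/24 (bL - uL + bR - uR))]. *)
Lemma heavy_bound (bL bR qL qR : R) :
  0 < qL -> 0 < qR -> 4 * PI ^ 2 / qL <= bL -> 4 * PI ^ 2 / qR <= bR ->
  qL + qR - 4 * PI ^ 2 / qL - 4 * PI ^ 2 / qR
    <= alpha * ((bL - 4 * PI ^ 2 / qL) + (bR - 4 * PI ^ 2 / qR)) ->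
  ZH_tilde alpha c spec bL bR <= wgt (qL, qR) * ZVir_reduced c spec qL qR.
Proof.
  intros HqL HqR HL HR Hc. pose proof PI_RGT_0 as HPI.
  assert (H4 : 0 < 4 * PI ^ 2) by nra.
  set (uL := 4 * PI ^ 2 / qL) in *. set (uR := 4 * PI ^ 2 / qR) in *.
  assert (HuL : 0 < uL) by (apply Rdiv_lt_0_compat; lra).
  assert (HuR : 0 < uR) by (apply Rdiv_lt_0_compat; lra).
  pose proof (ZVir_modular uL uR HuL HuR) as Hm.
  replace (4 * PI ^ 2 / uL) with qL in Hm by (unfold uL; field; lra).
  replace (4 * PI ^ 2 / uR) with qR in Hm by (unfold uR; field; lra).
  unfold ZVir_reduced. rewrite <- Rmult_assoc, <- Hm.
  set (A := (c - 1) / 24). assert (HA : 0 < A) by (unfold A; lra).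
  assert (HZ : ZVir c spec uL uR = ZVir_reduced c spec uL uR * exp (A * (uL + uR))).
  { unfold ZVir_reduced. fold A. rewrite Rmult_assoc, <- exp_plus.
    replace (- (A * (uL + uR)) + A * (uL + uR)) with 0 by ring. rewrite exp_0; ring. }
  rewrite HZ, (ZVir_reduced_split uL uR HuL HuR), Rmult_assoc, <- exp_plus.
  replace (A * (uL + uR) + - (A * (qL + qR))) with (- (A * (qL + qR - uL - uR))) by ring.
  set (F := exp (- (A * (qL + qR - uL - uR)))).
  assert (HF : 0 < F) by apply exp_pos.
  pose proof (ZL_tilde_pos uL uR HuL HuR) as HLp.
  (* The light part at [u] is positive and is dropped from the upper bound. *)
  apply Rle_trans with (ZH_tilde alpha c spec uL uR * F); [|nra].
  unfold ZH_tilde. rewrite <- Series_scal_r.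
  apply Series_le.
  2:{ apply ex_series_scal_r. apply (ex_series_split uL uR HuL HuR). }
  intros k. split; [apply ZH_term_nonneg|].
  unfold ZH_term. destruct (spec k) as [[h hb]|]; [|lra].
  replace (alpha * (c - 1) / 24) with (alpha * A) by (unfold A; field).
  destruct (Rle_dec (alpha * A) h) as [Hh|]; [|lra].
  destruct (Rle_dec (alpha * A) hb) as [Hhb|]; [|lra].
  unfold F. rewrite <- exp_plus.
  assert (Hle : - h * bL - hb * bR <= - h * uL - hb * uR + - (A * (qL + qR - uL - uR))).
  { assert (alpha * A * (bL - uL) <= h * (bL - uL)) by (apply Rmult_le_compat_r; lra).
    assert (alpha * A * (bR - uR) <= hb * (bR - uR)) by (apply Rmult_le_compat_r; lra).
    assert (A * (qL + qR - uL - uR) <= A * (alpha * (bL - uL + (bR - uR))))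
      by (apply Rmult_le_compat_l; lra).
    nra. }
  destruct Hle as [Hl|Hl]; [left; apply exp_increasing; exact Hl|right; f_equal; exact Hl].
Qed.

Lemma EVir_ln_reduced (bL bR : R) : 0 < bL -> 0 < bR ->
  0 < ZVir_reduced c spec bL bR /\ EVir c spec bL bR = ln (ZVir_reduced c spec bL bR).
Proof.
  intros HL HR.
  assert (Hp : 0 < ZVir_reduced c spec bL bR).
  { rewrite ZVir_reduced_split by assumption.
    pose proof (ZL_tilde_pos bL bR HL HR). pose proof (ZH_tilde_nonneg bL bR HL HR). lra. }
  split; [exact Hp|]. unfold EVir, ZVir_reduced in *.
  pose proof (exp_pos (- ((c - 1) / 24 * (bL + bR)))).
  rewrite ln_mult, ln_exp by first [apply exp_pos | nra]. ring.
Qed.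

End CFT.

(** * Geometry of one step of the algorithm *)

(* The part of the domain outside the stopping region, in terms of the smaller
   inverse temperature [x] and the larger one [y]. *)
Definition valid (alpha x y : R) : Prop :=
  0 < x <= 2 * PI /\ 2 * PI < y /\ 4 * PI ^ 2 < x * y /\
  4 * PI * alpha < x - (1 - alpha) * (4 * PI ^ 2 / x) + alpha * y.

(** The flag records which side carries the smaller value, so that the two branches of the algorithm
    are treated at once. *)
Definition orient (b : bool) (x y : R) : R * R := if b then (x, y) else (y, x).

Definition good (alpha : R) (p : R * R) : Prop :=
  A_stop p \/ exists b x y, p = orient b x y /\ valid alpha x y.

(** The [tilde b] of the algorithm. At [x = 2 pi] the self-dual value is replaced by a smaller one,
    so that its dual exceeds [2 pi]. *)
Definition shifted (alpha x y : R) : R :=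
  if Rlt_dec x (2 * PI) then x else 8 * PI ^ 2 / (alpha * (y - 2 * PI) + 4 * PI).

Definition step_root (alpha x y t : R) : Prop :=
  0 < t /\
  alpha * y + shifted alpha x y - 4 * PI ^ 2 / shifted alpha x y
    + (1 - alpha) * (4 * PI ^ 2 / t) - t = 0.

(** The flag flips because the dual of the smaller variable becomes the larger one, while [t] takes
    the other side. *)
Lemma A_step_orient (alpha x y : R) (b : bool) (q : R * R) : valid alpha x y ->
  (A_step alpha (orient b x y) q <->
   exists t, step_root alpha x y t /\ q = orient (negb b) t (4 * PI ^ 2 / shifted alpha x y)).
Proof.
  intros [[H0 Hx] [Hy _]]. unfold A_step, orient, step_root, shifted.
  destruct b; simpl negb; cbv iota.
  - destruct (Rle_dec x (2 * PI)); [|lra].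
    split; intros [t Ht]; exists t; tauto.
  - destruct (Rle_dec y (2 * PI)); [lra|].
    split; intros [t Ht]; exists t; tauto.
Qed.

Lemma valid_not_stop (alpha x y : R) (b : bool) : valid alpha x y -> ~ A_stop (orient b x y).
Proof. intros [[_ Hx] _] [H1 H2]. destruct b; simpl in *; lra. Qed.

Lemma sub_div_mono (m t x : R) : 0 <= m -> 0 < t <= x -> t - m / t <= x - m / x.
Proof.
  intros Hm Ht. assert (/ x <= / t) by (apply Rinv_le_contravar; lra).
  assert (m / x <= m / t) by (apply Rmult_le_compat_l; lra). lra.
Qed.

Lemma sub_div_lt_reg (m t x : R) : 0 <= m -> 0 < t -> 0 < x -> x - m / x < t - m / t -> x < t.
Proof.
  intros Hm Ht Hx H. destruct (Rlt_dec x t) as [|Hn]; [assumption|].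
  pose proof (sub_div_mono m t x Hm ltac:(lra)). lra.
Qed.

Lemma four_PI2_pos : 0 < 4 * PI ^ 2.
Proof. pose proof PI_RGT_0. nra. Qed.

Lemma div_dual_lt (x y : R) : 0 < x -> 4 * PI ^ 2 < x * y -> 4 * PI ^ 2 / x < y.
Proof.
  intros Hx H. apply Rmult_lt_reg_r with x; [exact Hx|].
  unfold Rdiv. rewrite Rmult_assoc, Rinv_l by lra. lra.
Qed.

Section Step.

Variables (alpha x y : R).
Hypothesis alpha_bound : 0 < alpha <= 1.
Hypothesis xy_valid : valid alpha x y.

Lemma shifted_bounds : 0 < shifted alpha x y /\ shifted alpha x y <= x /\ shifted alpha x y < 2 * PI.
Proof.
  destruct xy_valid as [[H0 Hx] [Hy [Hxy HC]]]. pose proof PI_RGT_0 as HPI. pose proof four_PI2_pos.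
  unfold shifted. destruct (Rlt_dec x (2 * PI)) as [Hl|Hl]; [lra|].
  assert (x = 2 * PI) by lra. assert (Hd : 0 < alpha * (y - 2 * PI)) by (apply Rmult_lt_0_compat; lra).
  assert (8 * PI ^ 2 / (alpha * (y - 2 * PI) + 4 * PI) < 2 * PI).
  { apply Rmult_lt_reg_r with (alpha * (y - 2 * PI) + 4 * PI); [lra|].
    unfold Rdiv. rewrite Rmult_assoc, Rinv_l by lra. nra. }
  split; [apply Rdiv_lt_0_compat; lra|lra].
Qed.

(* Strict monotonicity of [t - (1 - alpha) 4 pi^2 / t] turns this into [x < t]. *)
Lemma shifted_value_gt :
  x - (1 - alpha) * (4 * PI ^ 2) / x
  < alpha * y + shifted alpha x y - 4 * PI ^ 2 / shifted alpha x y.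
Proof.
  destruct xy_valid as [[H0 Hx] [Hy [Hxy HC]]]. pose proof PI_RGT_0 as HPI. pose proof four_PI2_pos.
  unfold shifted. destruct (Rlt_dec x (2 * PI)) as [Hl|Hl].
  - pose proof (div_dual_lt x y H0 Hxy).
    replace ((1 - alpha) * (4 * PI ^ 2) / x) with ((1 - alpha) * (4 * PI ^ 2 / x)) by (field; lra).
    nra.
  - assert (x = 2 * PI) by lra. subst x.
    replace ((1 - alpha) * (4 * PI ^ 2) / (2 * PI)) with ((1 - alpha) * (2 * PI)) by (field; lra).
    (* In terms of [d], the shifted value is [4 pi^2 / (2 pi + d)] and its dual is [2 pi + d]; the
       surplus in the inequality is [d^2 / (2 pi + d)]. *)
    set (d := alpha * (y - 2 * PI) / 2).
    assert (Hd : 0 < d).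
    { apply Rdiv_lt_0_compat; [|lra]. apply Rmult_lt_0_compat; lra. }
    replace (alpha * (y - 2 * PI) + 4 * PI) with (2 * (2 * PI + d)) by (unfold d; field).
    replace (4 * PI ^ 2 / (8 * PI ^ 2 / (2 * (2 * PI + d)))) with (2 * PI + d) by (field; lra).
    replace (alpha * y) with (2 * d + alpha * (2 * PI)) by (unfold d; field).
    assert (Hs : 0 < d ^ 2 / (2 * PI + d)) by (apply Rdiv_lt_0_compat; [nra|lra]).
    replace (8 * PI ^ 2 / (2 * (2 * PI + d))) with (2 * PI - d + d ^ 2 / (2 * PI + d))
      by (field; lra). lra.
Qed.

Lemma step_root_exists : exists t, step_root alpha x y t.
Proof.
  pose proof shifted_value_gt as Hv. pose proof shifted_bounds as Hb.
  destruct xy_valid as [[H0 Hx] _]. pose proof four_PI2_pos as HP.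
  set (r := alpha * y + shifted alpha x y - 4 * PI ^ 2 / shifted alpha x y) in *.
  set (m := (1 - alpha) * (4 * PI ^ 2)) in *.
  assert (Hm : 0 <= m) by (apply Rmult_le_pos; lra).
  assert (HD : 0 <= r ^ 2 + 4 * m) by (pose proof (pow2_ge_0 r); lra).
  (* The larger root of [t^2 = r t + m]. For [r <= 0] its positivity needs [m > 0]; if [m = 0],
     [shifted_value_gt] forces [r > x > 0]. *)
  set (t := (r + sqrt (r ^ 2 + 4 * m)) / 2).
  assert (Hsq : sqrt (r ^ 2 + 4 * m) ^ 2 = r ^ 2 + 4 * m) by (apply pow2_sqrt; exact HD).
  pose proof (sqrt_pos (r ^ 2 + 4 * m)) as Hsp.
  assert (Ht : 0 < t).
  { unfold t. destruct (Rlt_dec 0 r) as [Hr|Hr]; [lra|].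
    assert (Hm' : 0 < m).
    { destruct Hm as [Hm|Hm]; [exact Hm|]. rewrite <- Hm in Hv.
      unfold Rdiv in Hv. rewrite Rmult_0_l in Hv. lra. }
    nra. }
  exists t. split; [exact Ht|]. fold r.
  replace ((1 - alpha) * (4 * PI ^ 2 / t)) with (m / t) by (unfold m; field; lra).
  assert (Hq : t * t = r * t + m) by (unfold t; nra).
  apply Rmult_eq_reg_r with t; [|lra].
  replace ((r + m / t - t) * t) with (r * t + m - t * t) by (field; lra). lra.
Qed.

Variable t : R.
Hypothesis t_root : step_root alpha x y t.

Lemma step_root_value :
  t - (1 - alpha) * (4 * PI ^ 2) / t
  = alpha * y + shifted alpha x y - 4 * PI ^ 2 / shifted alpha x y.
Proof.
  destruct t_root as [Ht He].
  replace ((1 - alpha) * (4 * PI ^ 2) / t) with ((1 - alpha) * (4 * PI ^ 2 / t)) by (field; lra). lra.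
Qed.

Lemma step_root_gt : x < t.
Proof.
  pose proof shifted_value_gt as Hv. rewrite <- step_root_value in Hv.
  destruct xy_valid as [[H0 _] _]. destruct t_root as [Ht _]. pose proof four_PI2_pos.
  apply sub_div_lt_reg in Hv; [exact Hv| |exact Ht|exact H0].
  apply Rmult_le_pos; lra.
Qed.

Lemma step_dual_lt : 4 * PI ^ 2 / t < y.
Proof.
  pose proof step_root_gt. destruct xy_valid as [[H0 _] [Hy [Hxy _]]]. pose proof PI_RGT_0.
  apply div_dual_lt; nra.
Qed.

(** The equation for [t] gives equality up to the term [alpha * (x - shifted alpha x y)], which is
    nonnegative. This is the exponent condition of [heavy_bound]. *)
Lemma step_energy :
  4 * PI ^ 2 / shifted alpha x y + t - shifted alpha x y - 4 * PI ^ 2 / t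
  <= alpha * ((x - shifted alpha x y) + (y - 4 * PI ^ 2 / t)).
Proof.
  pose proof shifted_bounds as [_ [Hb _]]. destruct t_root as [Ht He].
  assert (0 <= alpha * (x - shifted alpha x y)) by (apply Rmult_le_pos; lra). lra.
Qed.

Lemma step_dual_gt : 2 * PI < 4 * PI ^ 2 / shifted alpha x y.
Proof.
  pose proof shifted_bounds as [Hp [_ Hb]]. pose proof PI_RGT_0.
  apply Rmult_lt_reg_r with (shifted alpha x y); [exact Hp|].
  replace (4 * PI ^ 2 / shifted alpha x y * shifted alpha x y) with (4 * PI ^ 2) by (field; lra). nra.
Qed.

(** Since [x < t <= 2 pi], no shift occurs; the equation for [t] then says that [C] keeps its value,
    and [t > x] gives the product condition. *)
Lemma step_valid : t <= 2 * PI -> valid alpha t (4 * PI ^ 2 / shifted alpha x y) /\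
  x < 2 * PI /\ shifted alpha x y = x.
Proof.
  intros Ht2. pose proof step_root_gt as Hg. pose proof step_dual_gt as Hd.
  pose proof step_root_value as Hv. pose proof PI_RGT_0.
  destruct xy_valid as [[H0 Hx] [Hy [Hxy HC]]]. destruct t_root as [Ht _].
  assert (Hlt : x < 2 * PI) by lra.
  assert (Hs : shifted alpha x y = x).
  { unfold shifted. destruct (Rlt_dec x (2 * PI)); [reflexivity|lra]. }
  rewrite Hs in *. split; [|tauto].
  replace ((1 - alpha) * (4 * PI ^ 2) / t) with ((1 - alpha) * (4 * PI ^ 2 / t)) in Hv
    by (field; lra).
  unfold valid. repeat split; try lra.
  assert (H1 : 0 < 4 * PI ^ 2 / x) by lra.
  replace (4 * PI ^ 2) with (x * (4 * PI ^ 2 / x)) at 1 by (field; lra).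
  apply Rmult_lt_compat_r; assumption.
Qed.

End Step.

(** * Starting points in the domain and termination *)

(** The first entry of the maximum in [phi] gives the product condition. The second is the positive
    root of [x^2 = r x + m], so lying above it gives [m / x < x - r], the condition on [C]. *)
Lemma phi_lt_valid (alpha x y : R) : 0 < alpha <= 1 -> 2 * PI < y -> phi alpha y < x ->
  x <= 2 * PI -> valid alpha x y.
Proof.
  intros Ha Hy Hphi Hx. pose proof PI_RGT_0. pose proof four_PI2_pos as HP.
  unfold phi in Hphi.
  set (r := alpha * (4 * PI - y)) in *.
  assert (H1 : 4 * PI ^ 2 / y < x) by (eapply Rle_lt_trans; [apply Rmax_l|exact Hphi]).
  assert (H2 : (r + sqrt (alpha ^ 2 * (4 * PI - y) ^ 2 + 16 * PI ^ 2 * (1 - alpha))) / 2 < x)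
    by (eapply Rle_lt_trans; [apply Rmax_r|exact Hphi]).
  assert (Hp : 0 < 4 * PI ^ 2 / y) by (apply Rdiv_lt_0_compat; lra).
  unfold valid. repeat split; try lra.
  - replace (4 * PI ^ 2) with ((4 * PI ^ 2 / y) * y) by (field; lra).
    apply Rmult_lt_compat_r; lra.
  - set (m := (1 - alpha) * (4 * PI ^ 2)).
    replace (alpha ^ 2 * (4 * PI - y) ^ 2 + 16 * PI ^ 2 * (1 - alpha)) with (r ^ 2 + 4 * m) in H2
      by (unfold r, m; ring).
    assert (Hm : 0 <= m) by (apply Rmult_le_pos; lra).
    pose proof (sqrt_pos (r ^ 2 + 4 * m)) as Hs.
    assert (Hsq : sqrt (r ^ 2 + 4 * m) ^ 2 = r ^ 2 + 4 * m)
      by (apply pow2_sqrt; pose proof (pow2_ge_0 r); lra).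
    assert (Hx2 : m < x * (x - r)).
    { assert (Hd : sqrt (r ^ 2 + 4 * m) < 2 * x - r) by lra. nra. }
    replace ((1 - alpha) * (4 * PI ^ 2 / x)) with (m / x) by (unfold m; field; lra).
    assert (m / x < x - r).
    { apply Rmult_lt_reg_r with x; [lra|]. unfold Rdiv.
      rewrite Rmult_assoc, Rinv_l by lra. lra. }
    unfold r in *. lra.
Qed.

Lemma in_D_good (alpha bL bR : R) : 0 < alpha <= 1 -> in_D alpha bL bR -> good alpha (bL, bR).
Proof.
  intros Ha [[H1 H2]|[H1 H2]].
  - destruct (Rle_dec bL (2 * PI)) as [Hl|Hl].
    + right. exists true, bL, bR. split; [reflexivity|]. apply phi_lt_valid; assumption.
    + left. split; simpl; lra.
  - destruct (Rle_dec bR (2 * PI)) as [Hl|Hl].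
    + right. exists false, bR, bL. split; [reflexivity|]. apply phi_lt_valid; assumption.
    + left. split; simpl; lra.
Qed.

Lemma good_pos (alpha : R) (p : R * R) : good alpha p -> 0 < fst p /\ 0 < snd p.
Proof.
  pose proof PI_RGT_0.
  intros [[H1 H2]|[b [x [y [-> [[H1 H2] [H3 _]]]]]]]; [lra|]. destruct b; simpl; lra.
Qed.

Lemma good_step (alpha x y t : R) (b : bool) : 0 < alpha <= 1 -> valid alpha x y ->
  step_root alpha x y t -> good alpha (orient b t (4 * PI ^ 2 / shifted alpha x y)).
Proof.
  intros Ha Hv Ht. pose proof (step_dual_gt _ _ _ Ha Hv).
  destruct (Rle_dec t (2 * PI)) as [Hl|Hl].
  - right. do 3 eexists. split; [reflexivity|]. apply step_valid; assumption.
  - left. unfold A_stop. destruct b; simpl; lra.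
Qed.

Lemma A_run_cons (alpha : R) (p q : R * R) (N : nat) (pts : nat -> R * R) :
  ~ A_stop p -> A_step alpha p q -> A_run alpha (fst q) (snd q) N pts ->
  exists pts', A_run alpha (fst p) (snd p) (S N) pts'.
Proof.
  intros Hp Hs [HN [H1 [Hst HE]]].
  exists (fun i => match i with S (S j) => pts (S j) | _ => p end).
  destruct p as [p1 p2], q as [q1 q2]; simpl in *.
  split; [lia|]. split; [reflexivity|]. split.
  - intros i Hi1 Hi2. destruct i as [|[|j]]; [lia| |].
    + rewrite H1. split; assumption.
    + apply Hst; lia.
  - destruct N as [|M]; [lia|exact HE].
Qed.

Lemma A_run_stop (alpha : R) (p : R * R) : A_stop p ->
  A_run alpha (fst p) (snd p) 1 (fun _ => p).
Proof.
  intros Hp. repeat split; try lia; [destruct p; reflexivity|apply Hp|apply Hp].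
Qed.

(** The value of [C] when [y = 4 pi^2 / x]; on valid points [C] exceeds it because
    [x y > 4 pi^2]. *)
Definition kinetic (alpha x : R) : R := x + (2 * alpha - 1) * (4 * PI ^ 2) / x.

(** A function [x + m / x] on an interval is bounded by its values at the ends; the sign of
    [m - 2 pi x] decides which end is used. *)
Lemma kinetic_le_max (alpha x0 x : R) : 0 < x0 <= x -> x <= 2 * PI ->
  kinetic alpha x <= kinetic alpha x0 \/ kinetic alpha x <= kinetic alpha (2 * PI).
Proof.
  intros H0 Hx. unfold kinetic. set (m := (2 * alpha - 1) * (4 * PI ^ 2)).
  destruct (Rle_dec m (2 * PI * x)) as [Hm|Hm].
  - right. assert (H : 0 <= (2 * PI - x) * (2 * PI * x - m) / (2 * PI * x)).
    { apply Rdiv_le_0_compat; [apply Rmult_le_pos; lra|]. apply Rmult_lt_0_compat; lra. }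
    replace ((2 * PI - x) * (2 * PI * x - m) / (2 * PI * x))
      with (2 * PI + m / (2 * PI) - (x + m / x)) in H by (field; lra). lra.
  - left. assert (H : 0 <= (x - x0) * (m - x0 * x) / (x0 * x)).
    { apply Rdiv_le_0_compat; [apply Rmult_le_pos; nra|]. apply Rmult_lt_0_compat; lra. }
    replace ((x - x0) * (m - x0 * x) / (x0 * x)) with (x0 + m / x0 - (x + m / x)) in H
      by (field; lra). lra.
Qed.

(* [C] is invariant under the steps with [x < 2 PI]; such a step raises
   [x - (1 - alpha) 4 pi^2 / x] by [C - kinetic alpha x], hence by at least [eps]. *)
Lemma A_run_exists_aux (alpha x0 C eps : R) (n : nat) :
  0 < alpha <= 1 -> 0 < x0 ->
  (forall x, x0 <= x <= 2 * PI -> eps <= C - kinetic alpha x) ->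
  forall (b : bool) (x y : R), valid alpha x y -> x0 <= x ->
  x - (1 - alpha) * (4 * PI ^ 2) / x + alpha * y = C ->
  (2 * PI - (1 - alpha) * (4 * PI ^ 2) / (2 * PI)) - (x - (1 - alpha) * (4 * PI ^ 2) / x)
    < INR n * eps ->
  exists N pts, A_run alpha (fst (orient b x y)) (snd (orient b x y)) N pts.
Proof.
  intros Ha Hx0 Heps. pose proof four_PI2_pos as HP.
  assert (Hm : 0 <= (1 - alpha) * (4 * PI ^ 2)) by (apply Rmult_le_pos; lra).
  induction n as [|n IH]; intros b x y Hv Hx HC Hn.
  - exfalso. destruct Hv as [Hv _]. pose proof (sub_div_mono _ x (2 * PI) Hm Hv).
    simpl in Hn. lra.
  - destruct (step_root_exists alpha x y Ha Hv) as [t Ht].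
    assert (Hst : A_step alpha (orient b x y) (orient (negb b) t (4 * PI ^ 2 / shifted alpha x y))).
    { apply A_step_orient; [exact Hv|]. exists t; tauto. }
    pose proof (valid_not_stop alpha x y b Hv) as Hns.
    assert (Hrun : exists N pts, A_run alpha
       (fst (orient (negb b) t (4 * PI ^ 2 / shifted alpha x y)))
       (snd (orient (negb b) t (4 * PI ^ 2 / shifted alpha x y))) N pts).
    { destruct (Rle_dec t (2 * PI)) as [Hl|Hl].
      - destruct (step_valid alpha x y Ha Hv t Ht Hl) as [Hv' [Hx2 Hs]].
        pose proof (step_root_gt alpha x y Ha Hv t Ht) as Hg.
        pose proof (step_root_value alpha x y t Ht) as Hval.
        rewrite Hs in *. destruct Hv as [[Hx1 _] _].
        pose proof (Heps x ltac:(lra)) as He. unfold kinetic in He.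
        replace (4 * PI ^ 2 / x) with ((1 - alpha) * (4 * PI ^ 2) / x + alpha * (4 * PI ^ 2) / x)
          in Hval by (field; lra).
        replace ((2 * alpha - 1) * (4 * PI ^ 2) / x)
          with (alpha * (4 * PI ^ 2) / x - (1 - alpha) * (4 * PI ^ 2) / x) in He by (field; lra).
        apply IH; [exact Hv'|lra| |].
        + replace (alpha * (4 * PI ^ 2 / x)) with (alpha * (4 * PI ^ 2) / x) by (field; lra). lra.
        + rewrite S_INR in Hn. lra.
      - exists 1%nat. eexists. apply A_run_stop.
        pose proof (step_dual_gt _ _ _ Ha Hv). unfold A_stop. destruct b; simpl; lra. }
    destruct Hrun as [N [pts Hrun]].
    exists (S N). exact (A_run_cons _ _ _ _ _ Hns Hst Hrun).
Qed.

Lemma A_run_exists (alpha bL bR : R) : 0 < alpha <= 1 -> in_D alpha bL bR ->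
  exists N pts, A_run alpha bL bR N pts.
Proof.
  intros Ha HD. destruct (in_D_good _ _ _ Ha HD) as [Hs|[b [x [y [E Hv]]]]].
  - exists 1%nat. eexists. apply (A_run_stop alpha (bL, bR) Hs).
  - change bL with (fst (bL, bR)). change bR with (snd (bL, bR)) at 2. rewrite E.
    assert (Hv' := Hv). destruct Hv' as [[H0 Hx] [Hy [Hxy HC]]].
    set (C := x - (1 - alpha) * (4 * PI ^ 2) / x + alpha * y).
    pose proof PI_RGT_0.
    assert (HC1 : kinetic alpha x < C).
    { pose proof (div_dual_lt x y H0 Hxy) as Hd. unfold kinetic, C.
      assert (alpha * (4 * PI ^ 2 / x) < alpha * y) by (apply Rmult_lt_compat_l; lra).
      replace ((2 * alpha - 1) * (4 * PI ^ 2) / x)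
        with (alpha * (4 * PI ^ 2 / x) - (1 - alpha) * (4 * PI ^ 2) / x) by (field; lra). lra. }
    assert (HC2 : kinetic alpha (2 * PI) < C).
    { unfold kinetic, C.
      replace ((1 - alpha) * (4 * PI ^ 2) / x) with ((1 - alpha) * (4 * PI ^ 2 / x)) by (field; lra).
      replace ((2 * alpha - 1) * (4 * PI ^ 2) / (2 * PI)) with ((2 * alpha - 1) * (2 * PI))
        by (field; lra). lra. }
    (* By [kinetic_le_max], the smaller of the gaps at the two ends bounds the gap on all of
       [[x, 2 pi]]. *)
    set (eps := Rmin (C - kinetic alpha x) (C - kinetic alpha (2 * PI))).
    assert (He : 0 < eps) by (apply Rmin_glb_lt; lra).
    set (gap := (2 * PI - (1 - alpha) * (4 * PI ^ 2) / (2 * PI)) - (x - (1 - alpha) * (4 * PI ^ 2) / x)).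
    destruct (INR_unbounded (gap / eps)) as [n Hn].
    apply (A_run_exists_aux alpha x C eps n); try assumption; try lra; try reflexivity.
    + intros z Hz. pose proof (Rmin_l (C - kinetic alpha x) (C - kinetic alpha (2 * PI))) as M1.
      pose proof (Rmin_r (C - kinetic alpha x) (C - kinetic alpha (2 * PI))) as M2.
      fold eps in M1, M2.
      destruct (kinetic_le_max alpha x z); lra.
    + fold gap. apply Rmult_lt_compat_r with (r := eps) in Hn; [|exact He].
      unfold Rdiv in Hn. rewrite Rmult_assoc, Rinv_l in Hn by lra. lra.
Qed.

(** * Accumulating the bound along a run *)

Lemma fold_right_Rplus_snoc (l : list R) (a : R) :
  fold_right Rplus 0 (l ++ a :: nil) = fold_right Rplus 0 l + a.
Proof. induction l as [|z l IH]; simpl; [ring|rewrite IH; ring]. Qed.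

Lemma fold_right_Rmult_snoc (l : list R) (a : R) :
  fold_right Rmult 1 (l ++ a :: nil) = fold_right Rmult 1 l * a.
Proof. induction l as [|z l IH]; simpl; [ring|rewrite IH; ring]. Qed.

Lemma prod_w_S (pts : nat -> R * R) (i : nat) : (1 <= i)%nat ->
  prod_w pts (S i) = prod_w pts i * wgt (pts (S i)).
Proof.
  intros Hi. unfold prod_w. destruct i as [|j]; [lia|].
  replace (S (S j) - 1)%nat with (S j) by lia. replace (S j - 1)%nat with j by lia.
  rewrite seq_S, map_app. simpl map at 2. rewrite fold_right_Rmult_snoc. reflexivity.
Qed.

Lemma prod_w_nonneg (pts : nat -> R * R) (i : nat) : 0 <= prod_w pts i.
Proof.
  unfold prod_w. induction (seq 2 (i - 1)) as [|z l IH]; simpl; [lra|].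
  apply Rmult_le_pos; [apply sqrt_pos|exact IH].
Qed.

Lemma good_heavy_bound (alpha c : R) (spec : spectrum) (p q : R * R) :
  0 < alpha <= 1 -> 1 < c -> is_CFT c spec -> good alpha p -> ~ A_stop p -> A_step alpha p q ->
  good alpha q /\
  ZH_tilde alpha c spec (fst p) (snd p) <= wgt q * ZVir_reduced c spec (fst q) (snd q).
Proof.
  intros Ha Hc Hcft [Hs|[b [x [y [-> Hv]]]]] Hns Hst; [contradiction|].
  apply A_step_orient in Hst; [|exact Hv]. destruct Hst as [t [Ht ->]].
  split; [apply good_step; assumption|].
  pose proof (shifted_bounds _ _ _ Ha Hv) as [Hs0 [Hs1 _]].
  pose proof (step_dual_gt _ _ _ Ha Hv) as Hd. pose proof PI_RGT_0.
  pose proof (step_dual_lt _ _ _ Ha Hv t Ht) as Hdl.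
  pose proof (step_energy _ _ _ Ha Hv t Ht) as He. destruct Ht as [Ht0 _].
  assert (Hdd : 4 * PI ^ 2 / (4 * PI ^ 2 / shifted alpha x y) = shifted alpha x y) by (field; lra).
  destruct b; cbn [orient negb fst snd]; apply heavy_bound; try assumption; rewrite ?Hdd; lra.
Qed.

Lemma bound_rhs_ge (alpha c : R) (spec : spectrum) (N : nat) (pts : nat -> R * R) :
  0 < alpha <= 1 -> 1 < c -> is_CFT c spec -> good alpha (pts 1%nat) ->
  (forall i, (1 <= i)%nat -> (i < N)%nat -> ~ A_stop (pts i) /\ A_step alpha (pts i) (pts (S i))) ->
  forall i, (S i <= N)%nat ->
  good alpha (pts (S i)) /\
  ZVir_reduced c spec (fst (pts 1%nat)) (snd (pts 1%nat)) <= bound_rhs alpha c spec (S i) pts.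
Proof.
  intros Ha Hc Hcft Hg Hst. induction i as [|i IH]; intros Hi.
  - split; [exact Hg|]. destruct (good_pos _ _ Hg).
    rewrite (ZVir_reduced_split alpha) by assumption.
    unfold bound_rhs, prod_w. simpl. lra.
  - destruct IH as [Hgi IH]; [lia|].
    destruct (Hst (S i) ltac:(lia) ltac:(lia)) as [Hns Hs].
    destruct (good_heavy_bound alpha c spec _ _ Ha Hc Hcft Hgi Hns Hs) as [Hg' Hh].
    split; [exact Hg'|]. eapply Rle_trans; [exact IH|].
    destruct (good_pos _ _ Hg') as [Hp1 Hp2].
    rewrite (ZVir_reduced_split alpha) in Hh by assumption.
    unfold bound_rhs. rewrite (seq_S (S i)), map_app. simpl map at 3.
    rewrite fold_right_Rplus_snoc, (prod_w_S pts (S i)) by lia.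
    pose proof (prod_w_nonneg pts (S i)) as Hw.
    (* The accumulated weight is nonnegative, so it may multiply the one-step bound. *)
    apply Rmult_le_compat_l with (r := prod_w pts (S i)) in Hh; [|exact Hw].
    lra.
Qed.

Theorem theorem2 :
  forall (alpha c : R) (spec : spectrum),
    0 < alpha <= 1 -> 1 < c -> is_CFT c spec ->
    forall bL bR : R, in_D alpha bL bR ->
      (exists (N : nat) (pts : nat -> R * R), A_run alpha bL bR N pts) /\
      (forall (N : nat) (pts : nat -> R * R), A_run alpha bL bR N pts ->
         EVir c spec bL bR <= ln (bound_rhs alpha c spec N pts)).
Proof.
  intros alpha c spec Ha Hc Hcft bL bR HD.
  split; [apply A_run_exists; assumption|].
  intros N pts [HN [H1 [Hst _]]].
  pose proof (in_D_good _ _ _ Ha HD) as Hg. destruct (good_pos _ _ Hg) as [HL HR].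
  destruct (EVir_ln_reduced alpha c spec Ha Hc Hcft bL bR HL HR) as [Hp ->].
  apply ln_le; [exact Hp|].
  rewrite <- H1 in Hg. destruct N as [|M]; [lia|].
  destruct (bound_rhs_ge alpha c spec (S M) pts Ha Hc Hcft Hg Hst M (Nat.le_refl _)) as [_ Hb].
  rewrite H1 in Hb. exact Hb.
Qed.
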